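(* There is an absolute constant $K>0$ such that the following holds. Let $x=[a_1;a_2,\ldots]\in(0,\infty)$ be irrational with partial quotients satisfying $a_n\le C$ for all $n\ge1$, for some constant $C>0$, and let $(A_n)_{n\ge0}$ be its associated sequence. For $m,n\ge0$ write $A_{m+n}=A_nB_{m,n}$. Then for every weakly holomorphic modular function $f$ for $\mathrm{SL}(2,\mathbb{Z})$, \[\big|I_f(A_{m+n})-I_f(A_n)-I_f(B_{m,n})\big|\le K\,C\sup_{t\in[\pi/3,2\pi/3]}|f(e^{it})|.\]
   Context: Let $T=\begin{pmatrix}1&1\\0&1\end{pmatrix}$, $V=\begin{pmatrix}1&0\\1&1\end{pmatrix}$. For irrational $x=[a_1;a_2,\ldots]$ ($a_1\ge0$, $a_i\ge1$ for $i\ge2$), $A_n=T^n$ for $0\le n\le a_1$; $A_n=T^{a_1}V^{a_2}\cdots V^{a_i}T^{k}$ if $n=a_1+\dots+a_i+k$, $0\le k\le a_{i+1}$, $i\ge1$ even; $A_n=T^{a_1}V^{a_2}\cdots T^{a_i}V^{k}$ if $n=a_1+\dots+a_i+k$, $0\le k\le a_{i+1}$, $i\ge1$ odd. (So $B_{m,n}=A_n^{-1}A_{m+n}\in\mathrm{SL}(2,\mathbb{Z}_{\ge0})$.) A weakly holomorphic modular function for $\mathrm{SL}(2,\mathbb{Z})$ is a holomorphic $\mathrm{SL}(2,\mathbb{Z})$-invariant function on $\mathbb{H}$ meromorphic at the cusp. For hyperbolic $A\in\mathrm{SL}(2,\mathbb{Z})$ with repelling/attracting fixed points $w,\tilde w$,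 let $Q(x,y)=ax^2+bxy+cy^2$ be the primitive integral form vanishing at $(w,1),(\tilde w,1)$ with $\mathrm{sgn}(a)=\mathrm{sgn}(w-\tilde w)$, $D=b^2-4ac$, and $I_f(A)=\int_{\tau_0}^{A\tau_0}\frac{f(\tau)\sqrt D}{Q(\tau,1)}d\tau$ ($\tau_0\in\mathbb{H}$ arbitrary); $I_f(A)=0$ if $A$ is not hyperbolic. *)

(* Defs.v *)
From Stdlib Require Export Reals ZArith.
From Stdlib Require Import ClassicalEpsilon.
From Coquelicot Require Export Coquelicot.

Open Scope R_scope.

(** * Integral 2x2 matrices *)

Record mat2 : Set := Mat2 { m11 : Z; m12 : Z; m21 : Z; m22 : Z }.

Definition mmul (A B : mat2) : mat2 :=
  Mat2 (m11 A * m11 B + m12 A * m21 B) (m11 A * m12 B + m12 A * m22 B)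
       (m21 A * m11 B + m22 A * m21 B) (m21 A * m12 B + m22 A * m22 B).

Definition mone : mat2 := Mat2 1 0 0 1.

Fixpoint mpow (A : mat2) (n : nat) : mat2 :=
  match n with O => mone | S n' => mmul A (mpow A n') end.

Definition mdet (A : mat2) : Z := (m11 A * m22 A - m12 A * m21 A)%Z.
Definition mtr (A : mat2) : Z := (m11 A + m22 A)%Z.

Definition in_SL2Z (A : mat2) : Prop := mdet A = 1%Z.

Definition matT : mat2 := Mat2 1 1 0 1.
Definition matV : mat2 := Mat2 1 0 1 1.

(** * Continued fractions and the sequence [A_n] *)

Definition irrational (x : R) : Prop :=
  forall p q : Z, q <> 0%Z -> x <> IZR p / IZR q.

(** Indices start at 0: if [x = [a_1; a_2, ...]], then
    [partial_quotient x i] is [a_(i+1)]. *)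
Fixpoint complete_quotient (x : R) (i : nat) : R :=
  match i with
  | O => x
  | S i' => / frac_part (complete_quotient x i')
  end.

Definition partial_quotient (x : R) (i : nat) : nat :=
  Z.to_nat (Int_part (complete_quotient x i)).

(** [a_1 + ... + a_i] *)
Fixpoint quotient_sum (x : R) (i : nat) : nat :=
  match i with
  | O => O
  | S i' => (quotient_sum x i' + partial_quotient x i')%nat
  end.

Definition letter (i : nat) : mat2 := if Nat.even i then matT else matV.

(** [T^(a_1) V^(a_2) T^(a_3) ...], with [i] factors. *)
Fixpoint block_product (x : R) (i : nat) : mat2 :=
  match i with
  | O => mone
  | S i' => mmul (block_product x i') (mpow (letter i') (partial_quotient x i'))
  end.

(** The case [i = 0] is [A_n = T^n] for [0 <= n <= a_1].  Consecutive cases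
    overlap at [k = a_(i+1)] and agree there, and for [x] irrational the sums
    [a_1 + ... + a_i] are unbounded, so every [A_n] is determined. *)
Definition associated_sequence (x : R) (A : nat -> mat2) : Prop :=
  forall i k : nat, (k <= partial_quotient x i)%nat ->
    A (quotient_sum x i + k)%nat = mmul (block_product x i) (mpow (letter i) k).

(** * Weakly holomorphic modular functions *)

Definition upper_half_plane (z : C) : Prop := 0 < Im z.

Definition ZtoC (n : Z) : C := RtoC (IZR n).

Definition mobius (A : mat2) (z : C) : C :=
  ((ZtoC (m11 A) * z + ZtoC (m12 A)) / (ZtoC (m21 A) * z + ZtoC (m22 A)))%C.

Definition C_differentiable (f : C -> C) (z : C) : Prop :=
  @ex_derive C_AbsRing C_NormedModule f z.

Definition Cexp (z : C) : C := (exp (Re z) * cos (Im z), exp (Re z) * sin (Im z)).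

Definition meromorphic_at (g : C -> C) (z0 : C) : Prop :=
  exists (N : nat) (h : C -> C),
    locally z0 (C_differentiable h) /\
    locally' z0 (fun z => g z = (h z / (z - z0) ^ N)%C).

(** [q = exp (2 pi i tau)] *)
Definition nome (tau : C) : C := Cexp (RtoC (2 * PI) * Ci * tau)%C.

Definition meromorphic_at_cusp (f : C -> C) : Prop :=
  exists g : C -> C,
    (forall tau, upper_half_plane tau -> f tau = g (nome tau)) /\
    meromorphic_at g (RtoC 0).

Definition weakly_holomorphic_modular (f : C -> C) : Prop :=
  (forall tau, upper_half_plane tau -> C_differentiable f tau) /\
  (forall A tau, in_SL2Z A -> upper_half_plane tau -> f (mobius A tau) = f tau) /\
  meromorphic_at_cusp f.

(** * Cycle integrals *)

Definition hyperbolic (A : mat2) : Prop := (2 < Z.abs (mtr A))%Z.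

Definition mobiusR (A : mat2) (x : R) : R :=
  (IZR (m11 A) * x + IZR (m12 A)) / (IZR (m21 A) * x + IZR (m22 A)).

(** Both fixed points of a hyperbolic element of [SL(2,Z)] are finite.  The
    first conjunct is needed because [/ 0 = 0] could make a pole at 0 look like
    a fixed point. *)
Definition fixed_point (A : mat2) (w : R) : Prop :=
  IZR (m21 A) * w + IZR (m22 A) <> 0 /\ mobiusR A w = w.

Definition repelling (A : mat2) (w : R) : Prop :=
  fixed_point A w /\ 1 < Rabs (Derive (mobiusR A) w).

Definition attracting (A : mat2) (w : R) : Prop :=
  fixed_point A w /\ Rabs (Derive (mobiusR A) w) < 1.

(** [a x^2 + b x y + c y^2] *)
Record qform : Set := QForm { qa : Z; qb : Z; qc : Z }.

Definition qeval (Q : qform) (x y : C) : C :=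
  (ZtoC (qa Q) * x ^ 2 + ZtoC (qb Q) * x * y + ZtoC (qc Q) * y ^ 2)%C.

Definition qdisc (Q : qform) : Z := (qb Q ^ 2 - 4 * qa Q * qc Q)%Z.

Definition primitive (Q : qform) : Prop :=
  Z.gcd (qa Q) (Z.gcd (qb Q) (qc Q)) = 1%Z.

Definition is_cycle_form (A : mat2) (Q : qform) : Prop :=
  exists w w' : R,
    repelling A w /\ attracting A w' /\ primitive Q /\
    qeval Q (RtoC w) (RtoC 1) = RtoC 0 /\ qeval Q (RtoC w') (RtoC 1) = RtoC 0 /\
    sign (IZR (qa Q)) = sign (w - w').

Definition cycle_form (A : mat2) : qform :=
  epsilon (inhabits (QForm 0 0 0)) (is_cycle_form A).

(** Integral of [F] along the line segment from [z0] to [z1]. *)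
Definition segment_integral (F : C -> C) (z0 z1 : C) : C :=
  RInt (V := C_R_CompleteNormedModule)
    (fun t : R => F (z0 + RtoC t * (z1 - z0)) * (z1 - z0))%C 0 1.

(** [I_f(A)] for [A] in [SL(2,Z)], computed from the base point [tau0].  The
    integrand is holomorphic on the convex set [H], so the path of integration
    in [H] is immaterial and the segment is used. *)
Definition cycle_integral (f : C -> C) (tau0 : C) (A : mat2) : C :=
  if excluded_middle_informative (hyperbolic A) then
    let Q := cycle_form A in
    segment_integral
      (fun tau => f tau * RtoC (sqrt (IZR (qdisc Q))) / qeval Q tau (RtoC 1))%C
      tau0 (mobius A tau0)
  else RtoC 0.

(** [sup |f(e^{it})|] over [pi/3 <= t <= 2 pi/3] *)
Definition arc_sup (f : C -> C) : Rbar :=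
  Lub_Rbar (fun y => exists t : R,
    PI / 3 <= t <= 2 * PI / 3 /\ y = Cmod (f (Cexp (Ci * RtoC t)%C))).

(* Main.v *)
(** Write [rho = e^(pi i/3)].  Both [T] and [V] map [rho^2] to [rho], so for a word
    [P = X_1 ... X_l] in [T] and [V] the path from [rho^2] to [P rho^2] can be taken as the union
    of the images under the prefixes [P_k = X_1 ... X_k] of the arc [e^(it)],
    [pi/3 <= t <= 2 pi/3].  For hyperbolic [P] with repelling and attracting fixed points
    [w < 0 < z] the integrand of [I_f(P)] is [f(tau) (1/(tau - w) - 1/(tau - z)) d tau], and
    pulling everything back to the arc gives
      [I_f(P) = int_arc f(tau) sum_(k < l) (1/(tau - P_k^(-1) w) - 1/(tau - P_k^(-1) z)) d tau].
    In [I_f(A_(m+n)) - I_f(A_n) - I_f(B)] the [k]-th terms are compared one by one: the points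
    concerned lie in a common interval, the image of [(0, oo)] under the suffix
    [X_(k+1) ... X_l], resp. of [(-oo, 0)] under [P_k^(-1)].  As no letter occurs more than
    [C] times in a row, the chordal length of these intervals is divided by at least [4] each
    time the word grows by [C + 1] letters, so that the sum over [k] is [O(C)]. *)

Require Import Defs.
From Stdlib Require Import Lra Lia ClassicalEpsilon.

(** * Complex derivatives and path integrals *)

(** The path of the overview is never built. Goursat's theorem for triangles gives every holomorphic
    function on the half-plane a primitive, and each integral becomes an increment of a primitive:
    translating an arc is then the chain rule, and concatenating arcs is telescoping. The three
    cycle integrals have three different pairs of fixed points. For a primitive [Phi] of the
    integrand of [A_(m+n) = A_n B], the increment from [rho2] to [A_n B rho2] is split at
    [A_n rho2], and each half is compared with the cycle integral of its own word. One lemma,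
    [wprod_cycle_defect], serves both halves, since it admits every kernel with poles [- x] and
    [W z], where [W] is the word and [x], [z] are any positive reals; the attracting fixed point of
    [W] has the form [W z], being its own image. A subword need not be hyperbolic, and its cycle
    integral is then 0 by convention. Such a subword has fewer than [N] letters, where [N] exceeds
    all partial quotients, so that bounding each arc trivially costs no more than the error already
    allowed. *)

Notation is_Cderive f z l := (@is_derive C_AbsRing C_NormedModule f z l).
Notation is_path_derive g t l := (@is_derive R_AbsRing C_R_NormedModule g t l).

(** Complex derivatives and derivatives along real paths live over different scalar fields. The
    epsilon-delta form, here and in the next lemma, is the common language in which the two are
    combined. *)
Lemma is_Cderive_eps (f : C -> C) (z l : C) :
  is_Cderive f z l <->
  forall eps, 0 < eps -> exists d, 0 < d /\ forall y, Cmod (y - z) < d ->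
    Cmod (f y - f z - l * (y - z)) <= eps * Cmod (y - z).
Proof.
split.
- intros [_ H] eps Heps.
  destruct (H z (fun P h => h) (mkposreal _ Heps)) as [d Hd].
  exists d; split; [apply cond_pos|]; intros y Hy.
  specialize (Hd y Hy); simpl in Hd.
  rewrite (Cmult_comm l).
  exact Hd.
- intros H; split; [apply is_linear_scal_l|].
  intros x Hx.
  rewrite <- (is_filter_lim_locally_unique _ _ Hx); clear x Hx.
  intros eps.
  destruct (H eps (cond_pos eps)) as [d [Hd Hy]].
  exists (mkposreal d Hd); intros y Hyd.
  specialize (Hy y Hyd); rewrite (Cmult_comm l) in Hy.
  exact Hy.
Qed.

Lemma is_path_derive_eps (g : R -> C) (t : R) (l : C) :
  is_path_derive g t l <->
  forall eps, 0 < eps -> exists d, 0 < d /\ forall s, Rabs (s - t) < d ->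
    Cmod (g s - g t - RtoC (s - t) * l) <= eps * Rabs (s - t).
Proof.
split.
- intros [_ H] eps Heps.
  destruct (H t (fun P h => h) (mkposreal _ Heps)) as [d Hd].
  exists d; split; [apply cond_pos|]; intros s Hs.
  specialize (Hd s Hs); simpl in Hd.
  rewrite Cmod_norm, <- scal_R_Cmult.
  exact Hd.
- intros H; split; [apply is_linear_scal_l|].
  intros x Hx.
  rewrite <- (is_filter_lim_locally_unique _ _ Hx); clear x Hx.
  intros eps.
  destruct (H eps (cond_pos eps)) as [d [Hd Hy]].
  exists (mkposreal d Hd); intros y Hyd.
  specialize (Hy y Hyd); rewrite Cmod_norm, <- scal_R_Cmult in Hy.
  exact Hy.
Qed.

Lemma Cmod_minus_sym (a b : C) : Cmod (a - b) = Cmod (b - a).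
Proof. rewrite <- Cmod_opp; f_equal; ring. Qed.

Lemma Cmod_triangle_minus (a b c : C) : Cmod (a - c) <= Cmod (a - b) + Cmod (b - c).
Proof. replace (a - c)%C with ((a - b) + (b - c))%C by ring. apply Cmod_triangle. Qed.

Lemma path_derive_comp (F : C -> C) (g : R -> C) (t : R) (l k : C) :
  is_Cderive F (g t) l -> is_path_derive g t k ->
  is_path_derive (fun s => F (g s)) t (l * k)%C.
Proof.
rewrite is_Cderive_eps, !is_path_derive_eps; intros HF Hg eps Heps.
assert (Hk := Cmod_ge_0 k); assert (Hl := Cmod_ge_0 l).
assert (He1 : 0 < eps / (2 * (Cmod k + 1))) by (apply Rdiv_lt_0_compat; lra).
assert (He2 : 0 < eps / (2 * (Cmod l + 1))) by (apply Rdiv_lt_0_compat; lra).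
destruct (HF _ He1) as [d1 [Hd1 H1]].
destruct (Hg _ He2) as [d2 [Hd2 H2]].
(* Accuracy 1 yields the Lipschitz bound [Hlip], which keeps [g s] within the range of [H1]. *)
destruct (Hg 1 Rlt_0_1) as [d3 [Hd3 H3]].
exists (Rmin (Rmin d2 d3) (d1 / (Cmod k + 1))); split.
  repeat apply Rmin_pos; try assumption; apply Rdiv_lt_0_compat; lra.
intros s Hs.
assert (Hs2 : Rabs (s - t) < d2).
  eapply Rlt_le_trans; [exact Hs|]; eapply Rle_trans; apply Rmin_l.
assert (Hs3 : Rabs (s - t) < d3).
  eapply Rlt_le_trans; [exact Hs|]; eapply Rle_trans; [apply Rmin_l|apply Rmin_r].
assert (Hs1 : Rabs (s - t) < d1 / (Cmod k + 1)).
  eapply Rlt_le_trans; [exact Hs|]; apply Rmin_r.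
specialize (H2 s Hs2); specialize (H3 s Hs3).
assert (Hlip : Cmod (g s - g t) <= (Cmod k + 1) * Rabs (s - t)).
  replace (g s - g t)%C with ((g s - g t - RtoC (s - t) * k) + RtoC (s - t) * k)%C by ring.
  eapply Rle_trans; [apply Cmod_triangle|].
  rewrite Cmod_mult, Cmod_R; lra.
assert (Hg1 : Cmod (g s - g t) < d1).
  eapply Rle_lt_trans; [exact Hlip|].
  replace d1 with ((Cmod k + 1) * (d1 / (Cmod k + 1))) by (field; lra).
  apply Rmult_lt_compat_l; lra.
specialize (H1 _ Hg1).
replace (F (g s) - F (g t) - RtoC (s - t) * (l * k))%C with
  ((F (g s) - F (g t) - l * (g s - g t)) + l * (g s - g t - RtoC (s - t) * k))%C by ring.
eapply Rle_trans; [apply Cmod_triangle|].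
rewrite Cmod_mult.
apply Rle_trans with (eps / (2 * (Cmod k + 1)) * ((Cmod k + 1) * Rabs (s - t))
  + (Cmod l + 1) * (eps / (2 * (Cmod l + 1)) * Rabs (s - t))).
- apply Rplus_le_compat.
  + eapply Rle_trans; [exact H1|]; apply Rmult_le_compat_l; lra.
  + apply Rmult_le_compat; try lra; apply Cmod_ge_0.
- right; field; lra.
Qed.

(** The product and chain rules use the ring as a module over itself, a different structure from
    [C_NormedModule] with the same little-o condition. *)
Lemma is_Cderive_AbsRing (f : C -> C) (z l : C) :
  @is_derive C_AbsRing (AbsRing_NormedModule C_AbsRing) f z l <-> is_Cderive f z l.
Proof.
split; intros [_ H]; (split; [apply is_linear_scal_l|]); exact H.
Qed.

Lemma is_Cderive_mult (f g : C -> C) (z df dg : C) :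
  is_Cderive f z df -> is_Cderive g z dg ->
  is_Cderive (fun t => (f t * g t)%C) z (df * g z + f z * dg)%C.
Proof.
rewrite <- !is_Cderive_AbsRing; intros Hf Hg.
exact (is_derive_mult (K := C_AbsRing) f g z df dg Hf Hg Cmult_comm).
Qed.

Lemma is_Cderive_minus (f g : C -> C) (z df dg : C) :
  is_Cderive f z df -> is_Cderive g z dg ->
  is_Cderive (fun t => (f t - g t)%C) z (df - dg)%C.
Proof. exact (is_derive_minus f g z df dg). Qed.

Lemma is_Cderive_comp (f g : C -> C) (z df dg : C) :
  is_Cderive f (g z) df -> is_Cderive g z dg ->
  is_Cderive (fun t => f (g t)) z (df * dg)%C.
Proof.
rewrite <- (is_Cderive_AbsRing g); intros Hf Hg.
rewrite Cmult_comm; exact (is_derive_comp f g z df dg Hf Hg).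
Qed.

Lemma is_Cderive_const (a z : C) : is_Cderive (fun _ => a) z (RtoC 0).
Proof. exact (is_derive_const a z). Qed.

Lemma is_Cderive_id (z : C) : is_Cderive (fun t => t) z (RtoC 1).
Proof. apply is_Cderive_AbsRing; exact (is_derive_id (K := C_AbsRing) z). Qed.

Lemma is_Cderive_ext_val (f : C -> C) (z l l' : C) :
  l = l' -> is_Cderive f z l -> is_Cderive f z l'.
Proof. now intros ->. Qed.

Lemma is_Cderive_linear (a b z : C) : is_Cderive (fun t => (a * t + b)%C) z a.
Proof.
apply is_Cderive_eps; intros eps Heps; exists 1; split; [lra|]; intros y _.
replace (a * y + b - (a * z + b) - a * (y - z))%C with (RtoC 0) by ring.
rewrite Cmod_0; apply Rmult_le_pos; [lra|apply Cmod_ge_0].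
Qed.

Lemma is_Cderive_inv (z : C) : z <> 0 -> is_Cderive Cinv z (- / (z * z))%C.
Proof.
intros Hz; apply is_Cderive_eps; intros eps Heps.
assert (Hm : 0 < Cmod z) by now apply Cmod_gt_0.
(* The error is exactly [(y - z)^2 / (y z^2)]; the first bound gives [|y| > |z| / 2], the second
   then makes the quotient by [|y - z|] at most [eps]. *)
exists (Rmin (Cmod z / 2) (eps * Cmod z ^ 3 / 2)); split.
  apply Rmin_pos; [lra|].
  assert (0 < Cmod z ^ 3) by now apply pow_lt.
  apply Rdiv_lt_0_compat; [|lra]; now apply Rmult_lt_0_compat.
intros y Hy.
assert (Hy1 : Cmod (y - z) < Cmod z / 2) by (eapply Rlt_le_trans; [exact Hy|apply Rmin_l]).
assert (Hy2 : Cmod (y - z) < eps * Cmod z ^ 3 / 2)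
  by (eapply Rlt_le_trans; [exact Hy|apply Rmin_r]).
assert (Hmy : Cmod z / 2 < Cmod y).
  assert (H := Cmod_triangle (z - y) y).
  replace (z - y + y)%C with z in H by ring.
  rewrite (Cmod_minus_sym z y) in H; lra.
assert (Hy0 : y <> 0) by (apply Cmod_gt_0; lra).
replace (/ y - / z - - / (z * z) * (y - z))%C with ((y - z) * ((y - z) / (y * (z * z))))%C
  by (field; split; assumption).
rewrite Cmod_mult, Rmult_comm.
apply Rmult_le_compat_r; [apply Cmod_ge_0|].
rewrite Cmod_div, !Cmod_mult by (repeat apply Cmult_neq_0; assumption).
apply Rle_trans with ((eps * Cmod z ^ 3 / 2) / (Cmod z / 2 * (Cmod z * Cmod z))).
- apply Rmult_le_compat.
  + apply Cmod_ge_0.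
  + left; apply Rinv_0_lt_compat; repeat apply Rmult_lt_0_compat; lra.
  + lra.
  + apply Rinv_le_contravar; [repeat apply Rmult_lt_0_compat; lra|].
    apply Rmult_le_compat_r; [|lra]; apply Rmult_le_pos; lra.
- right; field; lra.
Qed.

Definition holomorphic (F : C -> C) : Prop :=
  forall z, upper_half_plane z -> C_differentiable F z.

Definition is_primitive (F Phi : C -> C) : Prop :=
  forall z, upper_half_plane z -> is_Cderive Phi z (F z).

Lemma holomorphic_mult (F G : C -> C) :
  holomorphic F -> holomorphic G -> holomorphic (fun z => F z * G z)%C.
Proof.
intros HF HG z Hz; destruct (HF z Hz) as [a Ha], (HG z Hz) as [b Hb].
eexists; exact (is_Cderive_mult F G z a b Ha Hb).
Qed.

Lemma holomorphic_minus (F G : C -> C) :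
  holomorphic F -> holomorphic G -> holomorphic (fun z => F z - G z)%C.
Proof.
intros HF HG z Hz; destruct (HF z Hz) as [a Ha], (HG z Hz) as [b Hb].
eexists; exact (is_Cderive_minus F G z a b Ha Hb).
Qed.

Lemma holomorphic_linear (a b : C) : holomorphic (fun z => a * z + b)%C.
Proof. intros z _; eexists; apply is_Cderive_linear. Qed.

Lemma holomorphic_const (a : C) : holomorphic (fun _ => a).
Proof. intros z _; eexists; apply is_Cderive_const. Qed.

(* Requiring [g] to be an integral curve of a holomorphic vector field [k] (true for segments
   and for circular arcs) makes the integrand holomorphic in [g t], hence continuous. *)
Lemma is_RInt_primitive (F Phi k : C -> C) (g : R -> C) (a b : R) :
  holomorphic F -> is_primitive F Phi -> holomorphic k -> a <= b ->
  (forall t, a <= t <= b -> upper_half_plane (g t)) ->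
  (forall t, a <= t <= b -> is_path_derive g t (k (g t))) ->
  is_RInt (V := C_R_CompleteNormedModule) (fun t => F (g t) * k (g t))%C a b
    (Phi (g b) - Phi (g a))%C.
Proof.
intros HF HPhi Hk Hab Hg Hdg.
apply (is_RInt_derive (V := C_R_CompleteNormedModule) (fun t => Phi (g t)));
  rewrite Rmin_left, Rmax_right by assumption; intros t Ht.
- apply path_derive_comp; [apply HPhi, Hg, Ht|apply Hdg, Ht].
- destruct (holomorphic_mult F k HF Hk (g t) (Hg t Ht)) as [l Hl].
  apply (ex_derive_continuous (V := C_R_NormedModule)).
  eexists; exact (path_derive_comp _ g t _ _ Hl (Hdg t Ht)).
Qed.

Lemma Cmod_is_RInt_le (h : R -> C) (a b m : R) (l : C) :
  a <= b -> (forall t, a <= t <= b -> Cmod (h t) <= m) ->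
  is_RInt (V := C_R_CompleteNormedModule) h a b l -> Cmod l <= m * (b - a).
Proof.
intros Hab Hh Hl.
rewrite Cmod_norm.
apply (norm_RInt_le (V := C_R_NormedModule) h (fun _ => m) a b l); try assumption.
- intros t Ht; specialize (Hh t Ht); now rewrite Cmod_norm in Hh.
- rewrite Rmult_comm; apply (is_RInt_const (V := R_NormedModule)).
Qed.

Lemma Im_segment (a b : C) (t : R) : Im (a + RtoC t * (b - a))%C = (1 - t) * Im a + t * Im b.
Proof. destruct a, b; simpl; ring. Qed.

Lemma upper_half_plane_segment (a b : C) (t : R) :
  upper_half_plane a -> upper_half_plane b -> 0 <= t <= 1 ->
  upper_half_plane (a + RtoC t * (b - a))%C.
Proof. unfold upper_half_plane; rewrite Im_segment; intros; nra. Qed.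

Lemma is_path_derive_segment (a b : C) (t : R) :
  is_path_derive (fun s => a + RtoC s * (b - a))%C t (b - a)%C.
Proof.
apply is_path_derive_eps; intros eps Heps; exists 1; split; [lra|]; intros s _.
replace (a + RtoC s * (b - a) - (a + RtoC t * (b - a)) - RtoC (s - t) * (b - a))%C
  with (RtoC 0) by (rewrite RtoC_minus; ring).
rewrite Cmod_0; apply Rmult_le_pos; [lra|apply Rabs_pos].
Qed.

Lemma is_RInt_segment (F : C -> C) (a b : C) :
  holomorphic F -> upper_half_plane a -> upper_half_plane b ->
  is_RInt (V := C_R_CompleteNormedModule)
    (fun t : R => F (a + RtoC t * (b - a)) * (b - a))%C 0 1 (segment_integral F a b).
Proof.
intros HF Ha Hb.
apply RInt_correct, ex_RInt_continuous.
rewrite Rmin_left, Rmax_right by lra; intros t Ht.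
destruct (holomorphic_mult F (fun _ => b - a)%C HF (holomorphic_const _) _
  (upper_half_plane_segment a b t Ha Hb Ht)) as [l Hl].
apply (ex_derive_continuous (V := C_R_NormedModule)).
eexists; exact (path_derive_comp _ _ t _ _ Hl (is_path_derive_segment a b t)).
Qed.

Lemma segment_integral_primitive (F Phi : C -> C) (a b : C) :
  holomorphic F -> is_primitive F Phi -> upper_half_plane a -> upper_half_plane b ->
  segment_integral F a b = (Phi b - Phi a)%C.
Proof.
intros HF HPhi Ha Hb; unfold segment_integral.
apply (is_RInt_unique (V := C_R_CompleteNormedModule)).
assert (H := is_RInt_primitive F Phi (fun _ => b - a)%C (fun t => a + RtoC t * (b - a))%C
  0 1 HF HPhi (holomorphic_const _) Rle_0_1
  (fun t Ht => upper_half_plane_segment a b t Ha Hb Ht)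
  (fun t _ => is_path_derive_segment a b t)).
cbv beta in H.
replace (a + RtoC 1 * (b - a))%C with b in H by ring.
replace (a + RtoC 0 * (b - a))%C with a in H by ring.
exact H.
Qed.

(** Used with [l] the tangent affine function in Goursat's theorem, and with [l] constant to
    differentiate the primitive. *)
Lemma segment_integral_approx (F l L : C -> C) (a b : C) (m : R) :
  holomorphic F -> holomorphic l -> is_primitive l L ->
  upper_half_plane a -> upper_half_plane b ->
  (forall t, 0 <= t <= 1 ->
    Cmod (F (a + RtoC t * (b - a)) - l (a + RtoC t * (b - a))) <= m)%C ->
  Cmod (segment_integral F a b - (L b - L a)) <= m * Cmod (b - a).
Proof.
intros HF Hl HL Ha Hb Hm.
rewrite <- (segment_integral_primitive l L a b Hl HL Ha Hb).
replace (m * Cmod (b - a)) with (m * Cmod (b - a) * (1 - 0)) by ring.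
apply (Cmod_is_RInt_le (fun t => F (a + RtoC t * (b - a)) * (b - a)
   - l (a + RtoC t * (b - a)) * (b - a))%C); [lra| |].
- intros t Ht.
  replace (_ - _)%C with ((F (a + RtoC t * (b - a)) - l (a + RtoC t * (b - a))) * (b - a))%C
    by ring.
  rewrite Cmod_mult; apply Rmult_le_compat_r; [apply Cmod_ge_0|now apply Hm].
- exact (is_RInt_minus (V := C_R_NormedModule) _ _ 0 1 _ _
    (is_RInt_segment F a b HF Ha Hb) (is_RInt_segment l a b Hl Ha Hb)).
Qed.

Lemma is_RInt_C_ext (g h : R -> C) (a b : R) (l : C) :
  (forall t, g t = h t) -> is_RInt (V := C_R_NormedModule) g a b l ->
  is_RInt (V := C_R_NormedModule) h a b l.
Proof. intros H; apply (is_RInt_ext (V := C_R_NormedModule)); intros t _; apply H. Qed.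

Lemma is_RInt_affine (h : R -> C) (u v a b c d : R) (l : C) :
  is_RInt (V := C_R_NormedModule) h c d l -> u * a + v = c -> u * b + v = d ->
  is_RInt (V := C_R_NormedModule) (fun t => RtoC u * h (u * t + v)%R)%C a b l.
Proof.
intros H <- <-.
apply (is_RInt_comp_lin (V := C_R_NormedModule)) in H.
revert H; apply (is_RInt_ext (V := C_R_NormedModule)); intros t _.
now rewrite scal_R_Cmult.
Qed.

Lemma segment_integral_swap (F : C -> C) (a b : C) :
  holomorphic F -> upper_half_plane a -> upper_half_plane b ->
  segment_integral F b a = (- segment_integral F a b)%C.
Proof.
intros HF Ha Hb.
assert (H := is_RInt_segment F a b HF Ha Hb).
apply (is_RInt_swap (V := C_R_NormedModule)) in H.
unfold segment_integral at 1.
apply (is_RInt_unique (V := C_R_CompleteNormedModule)).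
apply (is_RInt_affine _ (-1) 1 0 1) in H; [|ring|ring].
revert H; apply is_RInt_C_ext; intros t.
replace (b + RtoC t * (a - b))%C with (a + RtoC (-1 * t + 1) * (b - a))%C
  by (rewrite RtoC_plus, RtoC_mult; ring).
ring.
Qed.

Definition midpoint (a b : C) : C := (RtoC (1 / 2) * (a + b))%C.

Lemma RtoC_half : (RtoC (1 / 2) + RtoC (1 / 2) = 1)%C.
Proof. rewrite <- RtoC_plus; f_equal; lra. Qed.

Lemma Cscal_half_double (z : C) : (RtoC (1 / 2) * z + RtoC (1 / 2) * z)%C = z.
Proof. transitivity ((RtoC (1 / 2) + RtoC (1 / 2)) * z)%C; [|rewrite RtoC_half]; ring. Qed.

Lemma midpoint_minus_l (a b : C) : (midpoint a b - a)%C = (RtoC (1 / 2) * (b - a))%C.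
Proof. unfold midpoint; rewrite <- (Cscal_half_double a) at 2; ring. Qed.

Lemma midpoint_minus_r (a b : C) : (b - midpoint a b)%C = (RtoC (1 / 2) * (b - a))%C.
Proof. unfold midpoint; rewrite <- (Cscal_half_double b) at 1; ring. Qed.

Lemma segment_integral_midpoint (F : C -> C) (a b : C) :
  holomorphic F -> upper_half_plane a -> upper_half_plane b ->
  segment_integral F a b =
    (segment_integral F a (midpoint a b) + segment_integral F (midpoint a b) b)%C.
Proof.
intros HF Ha Hb.
assert (H : ex_RInt (V := C_R_CompleteNormedModule)
    (fun t : R => F (a + RtoC t * (b - a)) * (b - a))%C 0 1)
  by (eexists; now apply is_RInt_segment).
assert (H1 := ex_RInt_Chasles_1 _ 0 (1 / 2) 1 ltac:(lra) H).
assert (H2 := ex_RInt_Chasles_2 _ 0 (1 / 2) 1 ltac:(lra) H).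
assert (H3 := RInt_correct _ _ _ H1); assert (H4 := RInt_correct _ _ _ H2).
apply (is_RInt_affine _ (1 / 2) 0 0 1) in H3; [|lra|lra].
apply (is_RInt_affine _ (1 / 2) (1 / 2) 0 1) in H4; [|lra|lra].
unfold segment_integral at 1.
rewrite <- (RInt_Chasles (V := C_R_CompleteNormedModule) _ 0 (1 / 2) 1 H1 H2).
apply (f_equal2 Cplus); symmetry; apply (is_RInt_unique (V := C_R_CompleteNormedModule)).
- revert H3; apply is_RInt_C_ext; intros t.
  rewrite midpoint_minus_l.
  replace (a + RtoC (1 / 2 * t + 0) * (b - a))%C with (a + RtoC t * (RtoC (1 / 2) * (b - a)))%C
    by (rewrite RtoC_plus, RtoC_mult; ring).
  ring.
- revert H4; apply is_RInt_C_ext; intros t.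
  rewrite midpoint_minus_r.
  replace (a + RtoC (1 / 2 * t + 1 / 2) * (b - a))%C
    with (midpoint a b + RtoC t * (RtoC (1 / 2) * (b - a)))%C.
    ring.
  rewrite RtoC_plus, RtoC_mult.
  replace (midpoint a b) with (a + RtoC (1 / 2) * (b - a))%C by (rewrite <- midpoint_minus_l; ring).
  ring.
Qed.

(** * Goursat's theorem *)

(** Iterates the bisection of triangles, which is known only as an existence statement; [Q] records
    how consecutive triangles are related. *)
Lemma dependent_choice (X : Type) (P : nat -> X -> Prop) (Q : nat -> X -> X -> Prop) (x0 : X) :
  P O x0 -> (forall n x, P n x -> exists y, P (S n) y /\ Q n x y) ->
  exists u : nat -> X, u O = x0 /\ forall n, P n (u n) /\ Q n (u n) (u (S n)).
Proof.
intros H0 H.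
set (next := fun n x => epsilon (inhabits x0) (fun y => P (S n) y /\ Q n x y)).
set (u := fix u n := match n with O => x0 | S n' => next n' (u n') end).
assert (HP : forall n, P n (u n)).
  induction n as [|n IH]; [exact H0|].
  exact (proj1 (epsilon_spec (inhabits x0) (fun y => P (S n) y /\ Q n (u n) y) (H n _ IH))).
exists u; split; [reflexivity|]; intros n; split; [apply HP|].
exact (proj2 (epsilon_spec (inhabits x0) (fun y => P (S n) y /\ Q n (u n) y) (H n _ (HP n)))).
Qed.

Lemma geometric_small (r e : R) : 0 < e -> exists n : nat, r / 2 ^ n < e.
Proof.
intros He.
destruct (pow_lt_1_zero (1 / 2) ltac:(rewrite Rabs_pos_eq; lra) (e / (Rabs r + 1))) as [n Hn].
  apply Rdiv_lt_0_compat; [lra|]; assert (H := Rabs_pos r); lra.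
exists n; specialize (Hn n (le_n n)).
assert (Hr := Rabs_pos r); assert (Hr' := Rle_abs r).
assert (H2 : 0 < 2 ^ n) by (apply pow_lt; lra).
rewrite Rabs_pos_eq in Hn by (apply pow_le; lra).
unfold Rdiv in Hn at 1; rewrite Rmult_1_l, pow_inv in Hn.
apply Rmult_lt_compat_l with (r := Rabs r + 1) in Hn; [|lra].
replace ((Rabs r + 1) * (e / (Rabs r + 1))) with e in Hn by (field; lra).
assert (0 < / 2 ^ n) by now apply Rinv_0_lt_compat.
unfold Rdiv; nra.
Qed.

(** The intervals of radius [2 * r / 2 ^ n] about [x n] are nested; [l] is the supremum of their
    left ends. *)
Lemma geometric_limit (x : nat -> R) (r : R) :
  (forall n, Rabs (x (S n) - x n) <= r / 2 ^ n) ->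
  exists l, forall n, Rabs (x n - l) <= 2 * r / 2 ^ n.
Proof.
intros H.
assert (Hstep : forall n, r / 2 ^ S n = r / 2 ^ n / 2)
  by (intros n; simpl; field; apply pow_nonzero; lra).
assert (Hmono : forall n k, x n - 2 * (r / 2 ^ n) <= x (n + k)%nat - 2 * (r / 2 ^ (n + k)) /\
                x (n + k)%nat + 2 * (r / 2 ^ (n + k)) <= x n + 2 * (r / 2 ^ n)).
  intros n k; induction k as [|k IH]; [rewrite Nat.add_0_r; lra|].
  rewrite Nat.add_succ_r, Hstep.
  assert (H1 := H (n + k)%nat); apply Rabs_le_between in H1; lra.
assert (Hcross : forall n k, x n - 2 * (r / 2 ^ n) <= x k + 2 * (r / 2 ^ k)).
  intros n k.
  assert (Hp : forall j, 0 <= r / 2 ^ j)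
    by (intros j; eapply Rle_trans; [apply Rabs_pos|apply H]).
  destruct (Nat.le_ge_cases n k) as [Hnk|Hnk].
  - destruct (Hmono n (k - n)%nat) as [H1 _].
    replace (n + (k - n))%nat with k in H1 by lia; specialize (Hp k); lra.
  - destruct (Hmono k (n - k)%nat) as [_ H1].
    replace (k + (n - k))%nat with n in H1 by lia; specialize (Hp n); lra.
destruct (completeness (fun y => exists n, y = x n - 2 * (r / 2 ^ n))) as [l [Hub Hlub]].
- exists (x O + 2 * (r / 2 ^ O)); intros y [n ->]; apply Hcross.
- eexists; exists O; reflexivity.
- exists l; intros n.
  assert (H1 : x n - 2 * (r / 2 ^ n) <= l) by (apply Hub; now exists n).
  assert (H2 : l <= x n + 2 * (r / 2 ^ n))
    by (apply Hlub; intros y [k ->]; apply Hcross).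
  replace (2 * r / 2 ^ n) with (2 * (r / 2 ^ n)) by (unfold Rdiv; ring).
  apply Rabs_le_between; lra.
Qed.

Lemma im_le_Cmod (z : C) : Rabs (Im z) <= Cmod z.
Proof. eapply Rle_trans; [apply Rmax_r|apply Rmax_Cmod]. Qed.

Lemma Cmod_le_Re_Im (z : C) : Cmod z <= Rabs (Re z) + Rabs (Im z).
Proof.
apply Rsqr_incr_0_var; [|assert (H1 := Rabs_pos (Re z)); assert (H2 := Rabs_pos (Im z)); lra].
unfold Rsqr; replace (Cmod z * Cmod z) with (Cmod z ^ 2) by ring.
rewrite Cmod2_alt, <- (pow2_abs (Re z)), <- (pow2_abs (Im z)).
assert (H1 := Rabs_pos (Re z)); assert (H2 := Rabs_pos (Im z)); nra.
Qed.

Lemma Cmod_segment_le (a b p : C) (t r : R) :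
  0 <= t <= 1 -> Cmod (a - p) <= r -> Cmod (b - p) <= r ->
  Cmod (a + RtoC t * (b - a) - p) <= r.
Proof.
intros Ht Ha Hb.
replace (a + RtoC t * (b - a) - p)%C
  with (RtoC (1 - t) * (a - p) + RtoC t * (b - p))%C by (rewrite RtoC_minus; ring).
eapply Rle_trans; [apply Cmod_triangle|].
rewrite !Cmod_mult, !Cmod_R, !Rabs_pos_eq by lra; nra.
Qed.

Lemma Im_midpoint (a b : C) : Im (midpoint a b) = (Im a + Im b) / 2.
Proof. unfold midpoint; rewrite im_scal_l; destruct a, b; simpl; field. Qed.

Lemma Cmod_half (z : C) : Cmod (RtoC (1 / 2) * z) = Cmod z / 2.
Proof. rewrite Cmod_mult, Cmod_R, Rabs_pos_eq by lra; field. Qed.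

Lemma is_primitive_affine (l k : C) :
  is_primitive (fun z => l * z + k)%C (fun z => z * (RtoC (1 / 2) * l * z + k))%C.
Proof.
intros z _.
eapply is_Cderive_ext_val; [|apply (is_Cderive_mult (fun t => t)
  (fun t => (RtoC (1 / 2) * l * t + k)%C)); [apply is_Cderive_id|apply is_Cderive_linear]].
cbv beta; rewrite <- (Cscal_half_double (l * z)) at 1; ring.
Qed.

Section Goursat.

Variable F : C -> C.
Hypothesis HF : holomorphic F.

Definition triangle_integral (a b c : C) : C :=
  (segment_integral F a b + segment_integral F b c + segment_integral F c a)%C.

(** Each side of the inner triangle is traversed once in either direction, so these contributions
    cancel. *)
Lemma triangle_integral_split (a b c : C) :
  upper_half_plane a -> upper_half_plane b -> upper_half_plane c ->
  triangle_integral a b c =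
    (triangle_integral a (midpoint a b) (midpoint c a)
     + triangle_integral (midpoint a b) b (midpoint b c)
     + triangle_integral (midpoint c a) (midpoint b c) c
     + triangle_integral (midpoint b c) (midpoint c a) (midpoint a b))%C.
Proof.
intros Ha Hb Hc.
assert (Hm : forall u v, upper_half_plane u -> upper_half_plane v ->
          upper_half_plane (midpoint u v))
  by (unfold upper_half_plane; intros u v; rewrite Im_midpoint; lra).
unfold triangle_integral.
rewrite (segment_integral_midpoint F a b), (segment_integral_midpoint F b c),
  (segment_integral_midpoint F c a) by assumption.
rewrite (segment_integral_swap F (midpoint b c) (midpoint c a)),
  (segment_integral_swap F (midpoint c a) (midpoint a b)),
  (segment_integral_swap F (midpoint a b) (midpoint b c)) by auto.
ring.
Qed.

(** The lower bound [d] on heights is inherited by midpoints; it keeps the limit of the nested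
    triangles inside the open half-plane. *)
Definition small_triangle (d r : R) (a b c : C) : Prop :=
  (d <= Im a /\ d <= Im b /\ d <= Im c) /\
  (Cmod (b - a) <= r /\ Cmod (c - b) <= r /\ Cmod (a - c) <= r).

(** Pigeonhole: one of the four half-size triangles carries at least a quarter of the integral. *)
Lemma triangle_bisection (d r : R) (a b c : C) :
  0 < d -> small_triangle d r a b c ->
  exists a' b' c', small_triangle d (r / 2) a' b' c' /\ Cmod (a' - a) <= r /\
    Cmod (triangle_integral a b c) <= 4 * Cmod (triangle_integral a' b' c').
Proof.
intros Hd [[Ha [Hb Hc]] [Hab [Hbc Hca]]].
assert (H := triangle_integral_split a b c (Rlt_le_trans _ _ _ Hd Ha)
  (Rlt_le_trans _ _ _ Hd Hb) (Rlt_le_trans _ _ _ Hd Hc)).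
set (ab := midpoint a b) in *; set (bc := midpoint b c) in *; set (ca := midpoint c a) in *.
assert (Hr : 0 <= r) by (eapply Rle_trans; [apply Cmod_ge_0|exact Hab]).
assert (Iab : d <= Im ab) by (unfold ab; rewrite Im_midpoint; lra).
assert (Ibc : d <= Im bc) by (unfold bc; rewrite Im_midpoint; lra).
assert (Ica : d <= Im ca) by (unfold ca; rewrite Im_midpoint; lra).
assert (E1 : Cmod (ab - a) <= r / 2) by (unfold ab; rewrite midpoint_minus_l, Cmod_half; lra).
assert (E2 : Cmod (b - ab) <= r / 2) by (unfold ab; rewrite midpoint_minus_r, Cmod_half; lra).
assert (E3 : Cmod (bc - b) <= r / 2) by (unfold bc; rewrite midpoint_minus_l, Cmod_half; lra).
assert (E4 : Cmod (c - bc) <= r / 2) by (unfold bc; rewrite midpoint_minus_r, Cmod_half; lra).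
assert (E5 : Cmod (ca - c) <= r / 2) by (unfold ca; rewrite midpoint_minus_l, Cmod_half; lra).
assert (E6 : Cmod (a - ca) <= r / 2) by (unfold ca; rewrite midpoint_minus_r, Cmod_half; lra).
assert (E7 : Cmod (bc - ab) <= r / 2).
  replace (bc - ab)%C with (- (RtoC (1 / 2) * (a - c)))%C by (unfold bc, ab, midpoint; ring).
  rewrite Cmod_opp, Cmod_half; lra.
assert (E8 : Cmod (ca - bc) <= r / 2).
  replace (ca - bc)%C with (- (RtoC (1 / 2) * (b - a)))%C by (unfold bc, ca, midpoint; ring).
  rewrite Cmod_opp, Cmod_half; lra.
assert (E9 : Cmod (ab - ca) <= r / 2).
  replace (ab - ca)%C with (- (RtoC (1 / 2) * (c - b)))%C by (unfold ca, ab, midpoint; ring).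
  rewrite Cmod_opp, Cmod_half; lra.
assert (HT : Cmod (triangle_integral a b c) <=
  Cmod (triangle_integral a ab ca) + Cmod (triangle_integral ab b bc)
  + Cmod (triangle_integral ca bc c) + Cmod (triangle_integral bc ca ab)).
  rewrite H.
  do 2 (eapply Rle_trans; [apply Cmod_triangle|]; apply Rplus_le_compat_r).
  apply Cmod_triangle.
set (T := Cmod (triangle_integral a b c)) in *.
destruct (Rle_dec T (4 * Cmod (triangle_integral a ab ca))) as [H1|H1].
  exists a, ab, ca; repeat split; try lra;
    try (rewrite Cmod_minus_sym; assumption); try assumption.
  replace (a - a)%C with (RtoC 0) by ring; rewrite Cmod_0; lra.
destruct (Rle_dec T (4 * Cmod (triangle_integral ab b bc))) as [H2|H2].
  exists ab, b, bc; repeat split; try lra;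
    try (rewrite Cmod_minus_sym; assumption); try assumption.
destruct (Rle_dec T (4 * Cmod (triangle_integral ca bc c))) as [H3|H3].
  exists ca, bc, c; repeat split; try lra;
    try (rewrite Cmod_minus_sym; assumption); try assumption.
  rewrite Cmod_minus_sym; lra.
exists bc, ca, ab; repeat split; try lra; try assumption.
eapply Rle_trans; [apply (Cmod_triangle_minus bc ab)|]; lra.
Qed.

(** The affine function [l * z + k] tangent to [F] at [p] has a primitive, so it integrates to 0
    around the triangle and only the remainder counts. *)
Lemma triangle_integral_local (p l a b c : C) (e r : R) :
  upper_half_plane a -> upper_half_plane b -> upper_half_plane c ->
  0 <= e -> Cmod (a - p) <= r -> Cmod (b - p) <= r -> Cmod (c - p) <= r ->
  (forall y, Cmod (y - p) <= r -> Cmod (F y - F p - l * (y - p)) <= e * Cmod (y - p)) ->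
  Cmod (triangle_integral a b c) <=
    e * r * (Cmod (b - a) + Cmod (c - b) + Cmod (a - c)).
Proof.
intros Ha Hb Hc He Hpa Hpb Hpc Hloc.
set (k := (F p - l * p)%C).
set (L := fun z => (z * (RtoC (1 / 2) * l * z + k))%C).
assert (Hedge : forall u v, upper_half_plane u -> upper_half_plane v ->
   Cmod (u - p) <= r -> Cmod (v - p) <= r ->
   Cmod (segment_integral F u v - (L v - L u)) <= e * r * Cmod (v - u)).
  intros u v Hu Hv Hpu Hpv.
  apply (segment_integral_approx F (fun z => l * z + k)%C L); try assumption.
    apply holomorphic_linear.
    apply is_primitive_affine.
  intros t Ht.
  set (y := (u + RtoC t * (v - u))%C).
  assert (Hy : Cmod (y - p) <= r) by now apply Cmod_segment_le.
  replace (F y - (l * y + k))%C with (F y - F p - l * (y - p))%C by (unfold k; ring).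
  eapply Rle_trans; [now apply Hloc|]; now apply Rmult_le_compat_l.
unfold triangle_integral.
replace (_ + _ + _)%C with ((segment_integral F a b - (L b - L a))
  + (segment_integral F b c - (L c - L b)) + (segment_integral F c a - (L a - L c)))%C by ring.
do 2 rewrite Rmult_plus_distr_l.
eapply Rle_trans; [apply Cmod_triangle|]; apply Rplus_le_compat; [|now apply Hedge].
eapply Rle_trans; [apply Cmod_triangle|]; apply Rplus_le_compat; now apply Hedge.
Qed.

Lemma goursat (a b c : C) :
  upper_half_plane a -> upper_half_plane b -> upper_half_plane c ->
  triangle_integral a b c = 0.
Proof.
intros Ha Hb Hc; unfold upper_half_plane in *.
set (d := Rmin (Im a) (Rmin (Im b) (Im c))).
assert (Hd : 0 < d) by (repeat apply Rmin_pos; assumption).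
set (r := Rmax (Cmod (b - a)) (Rmax (Cmod (c - b)) (Cmod (a - c)))).
set (T := Cmod (triangle_integral a b c)).
destruct (dependent_choice (C * C * C)
  (fun n t => let '(a, b, c) := t in small_triangle d (r / 2 ^ n) a b c /\
     T <= 4 ^ n * Cmod (triangle_integral a b c))
  (fun n t t' => Cmod (fst (fst t') - fst (fst t)) <= r / 2 ^ n) (a, b, c))
  as [u [_ Hu]].
- split; [|unfold T; simpl; lra].
  replace (r / 2 ^ 0) with r by (simpl; field).
  repeat split.
  + apply Rmin_l.
  + eapply Rle_trans; [apply Rmin_r|apply Rmin_l].
  + eapply Rle_trans; [apply Rmin_r|apply Rmin_r].
  + apply Rmax_l.
  + eapply Rle_trans; [apply Rmax_l|apply Rmax_r].
  + eapply Rle_trans; [apply Rmax_r|apply Rmax_r].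
- intros n [[a1 b1] c1] [Hs HT].
  destruct (triangle_bisection d _ a1 b1 c1 Hd Hs) as (a2 & b2 & c2 & Hs2 & Hm & HT2).
  exists (a2, b2, c2); split; [split|exact Hm].
  + replace (r / 2 ^ S n) with (r / 2 ^ n / 2) by (simpl; field; apply pow_nonzero; lra).
    exact Hs2.
  + eapply Rle_trans; [exact HT|]; simpl.
    assert (0 < 4 ^ n) by (apply pow_lt; lra); nra.
- assert (Hx : exists x, forall n, Rabs (Re (fst (fst (u n))) - x) <= 2 * r / 2 ^ n).
    apply geometric_limit; intros n; destruct (Hu n) as [_ H].
    eapply Rle_trans; [|exact H]; eapply Rle_trans; [|apply re_le_Cmod]; right; reflexivity.
  assert (Hy : exists y, forall n, Rabs (Im (fst (fst (u n))) - y) <= 2 * r / 2 ^ n).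
    apply geometric_limit; intros n; destruct (Hu n) as [_ H].
    eapply Rle_trans; [|exact H]; eapply Rle_trans; [|apply im_le_Cmod]; right; reflexivity.
  destruct Hx as [x Hx], Hy as [y Hy].
  set (p := (x, y) : C).
  assert (Hp : forall n, Cmod (fst (fst (u n)) - p) <= 4 * (r / 2 ^ n)).
    intros n; eapply Rle_trans; [apply Cmod_le_Re_Im|].
    specialize (Hx n); specialize (Hy n).
    replace (4 * (r / 2 ^ n)) with (2 * r / 2 ^ n + 2 * r / 2 ^ n) by (unfold Rdiv; ring).
    now apply Rplus_le_compat.
  assert (HpH : upper_half_plane p).
    destruct (geometric_small (2 * r) d Hd) as [n Hn].
    specialize (Hy n); apply Rabs_le_between in Hy.
    destruct (Hu n) as [H _]; destruct (u n) as [[a1 b1] c1].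
    destruct H as [[[Ha1 _] _] _]; simpl in Hy.
    unfold upper_half_plane; simpl; unfold Im in *; lra.
  apply Cmod_eq_0; fold T.
  apply Rle_antisym; [|apply Cmod_ge_0].
  apply Rnot_lt_le; intros HT.
  destruct (HF p HpH) as [l Hl].
  assert (Hr : 0 <= r) by (eapply Rle_trans; [apply Cmod_ge_0|apply Rmax_l]).
  (* The local estimate will give [T <= 15 * e * r ^ 2], which this choice contradicts; the [+ 1]
     covers [r = 0]. *)
  set (e := T / (15 * r ^ 2 + 1) / 2).
  assert (He : 0 < e) by (unfold e; repeat apply Rdiv_lt_0_compat; nra).
  destruct (proj1 (is_Cderive_eps F p l) Hl e He) as [d' [Hd' Hloc]].
  (* With [s = r / 2 ^ n], the first vertex is within [4 * s] of [p] and the sides are at most [s],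
     so all vertices are within [5 * s]. *)
  destruct (geometric_small (5 * r) d' Hd') as [n Hn].
  specialize (Hp n); destruct (Hu n) as [H _]; destruct (u n) as [[a1 b1] c1]; simpl in Hp.
  destruct H as [[[Ha1 [Hb1 Hc1]] [Hab [Hbc Hca]]] HT1].
  set (s := r / 2 ^ n) in *.
  assert (Hs : 5 * s < d') by (unfold s, Rdiv in *; lra).
  assert (H := triangle_integral_local p l a1 b1 c1 e (5 * s)
    (Rlt_le_trans _ _ _ Hd Ha1) (Rlt_le_trans _ _ _ Hd Hb1) (Rlt_le_trans _ _ _ Hd Hc1)
    (Rlt_le _ _ He)).
  assert (Hs0 : 0 <= s) by (eapply Rle_trans; [apply Cmod_ge_0|exact Hab]).
  assert (H' : Cmod (triangle_integral a1 b1 c1) <= e * (5 * s) * (s + s + s)).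
    eapply Rle_trans; [apply H|apply Rmult_le_compat_l; [nra|lra]].
    + lra.
    + eapply Rle_trans; [apply (Cmod_triangle_minus b1 a1)|]; lra.
    + eapply Rle_trans; [apply (Cmod_triangle_minus c1 a1)|].
      rewrite (Cmod_minus_sym c1 a1); lra.
    + intros z Hz; apply Hloc; lra.
  assert (H4 : 0 < 4 ^ n) by (apply pow_lt; lra).
  assert (H5 : T <= 15 * e * r ^ 2).
    eapply Rle_trans; [exact HT1|].
    apply Rle_trans with (4 ^ n * (e * (5 * s) * (s + s + s))); [apply Rmult_le_compat_l; lra|].
    right; unfold s; replace 4 with (2 * 2) at 1 by ring; rewrite Rpow_mult_distr.
    field; apply pow_nonzero; lra.
  assert (H6 : T = e * (2 * (15 * r ^ 2 + 1))) by (unfold e; field; nra).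
  nra.
Qed.

(** The primitive is the integral along the segment from [Ci]. Goursat's theorem for [Ci], [z], [y]
    turns its increment into the integral from [z] to [y], which is close to [F z * (y - z)]. *)
Lemma holomorphic_has_primitive : exists Phi, is_primitive F Phi.
Proof.
assert (Hi : upper_half_plane Ci) by (unfold upper_half_plane; simpl; lra).
exists (fun z => segment_integral F Ci z); intros z Hz.
apply is_Cderive_eps; intros e He.
destruct (HF z Hz) as [l Hl].
assert (Hml := Cmod_ge_0 l).
destruct (proj1 (is_Cderive_eps F z l) Hl 1 Rlt_0_1) as [d1 [Hd1 H1]].
(* The three bounds make [F] Lipschitz near [z] with constant [Cmod l + 1], keep [y] in the
   half-plane, and bring the variation of [F] below [e]. *)
set (d := Rmin (Rmin d1 (Im z)) (e / (Cmod l + 1))).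
assert (Hd : 0 < d) by (repeat apply Rmin_pos; try assumption; apply Rdiv_lt_0_compat; lra).
exists d; split; [exact Hd|]; intros y Hy.
assert (Hy1 : Cmod (y - z) < d1)
  by (eapply Rlt_le_trans; [exact Hy|]; eapply Rle_trans; [apply Rmin_l|apply Rmin_l]).
assert (Hy2 : Cmod (y - z) < Im z)
  by (eapply Rlt_le_trans; [exact Hy|]; eapply Rle_trans; [apply Rmin_l|apply Rmin_r]).
assert (Hy3 : Cmod (y - z) < e / (Cmod l + 1))
  by (eapply Rlt_le_trans; [exact Hy|]; apply Rmin_r).
assert (HyH : upper_half_plane y).
  assert (H := im_le_Cmod (y - z)); apply Rabs_le_between in H.
  unfold upper_half_plane; destruct y, z; unfold Im in *; simpl in *; lra.
assert (HG := goursat Ci z y Hi Hz HyH); unfold triangle_integral in HG.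
rewrite (segment_integral_swap F Ci y HF Hi HyH) in HG.
replace (segment_integral F Ci y - segment_integral F Ci z)%C with (segment_integral F z y)
  by (rewrite <- (Cplus_0_l (_ - _)), <- HG; ring).
replace (F z * (y - z))%C with (y * (RtoC (1 / 2) * 0 * y + F z)
  - z * (RtoC (1 / 2) * 0 * z + F z))%C by ring.
apply (segment_integral_approx F (fun z0 => 0 * z0 + F z)%C
  (fun z0 => z0 * (RtoC (1 / 2) * 0 * z0 + F z))%C); try assumption.
- apply holomorphic_linear.
- apply is_primitive_affine.
- intros t Ht.
  set (w := (z + RtoC t * (y - z))%C).
  assert (Hw : Cmod (w - z) <= Cmod (y - z)).
    apply Cmod_segment_le; [assumption| |lra].
    replace (z - z)%C with (RtoC 0) by ring; rewrite Cmod_0; apply Cmod_ge_0.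
  replace (F w - (0 * w + F z))%C with ((F w - F z - l * (w - z)) + l * (w - z))%C by ring.
  eapply Rle_trans; [apply Cmod_triangle|]; rewrite Cmod_mult.
  assert (H2 := H1 w (Rle_lt_trans _ _ _ Hw Hy1)).
  apply Rle_trans with ((Cmod l + 1) * Cmod (w - z)); [lra|].
  apply Rle_trans with ((Cmod l + 1) * (e / (Cmod l + 1))).
    apply Rmult_le_compat_l; lra.
  right; field; lra.
Qed.

End Goursat.

(** * Moebius transformations and kernels *)

Lemma primitive_eq (F Phi Psi : C -> C) (a b : C) :
  holomorphic F -> is_primitive F Phi -> is_primitive F Psi ->
  upper_half_plane a -> upper_half_plane b -> (Phi b - Phi a)%C = (Psi b - Psi a)%C.
Proof.
intros HF H1 H2 Ha Hb.
now rewrite <- (segment_integral_primitive F Phi), <- (segment_integral_primitive F Psi).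
Qed.

Lemma is_primitive_minus (F G Phi Psi : C -> C) :
  is_primitive F Phi -> is_primitive G Psi ->
  is_primitive (fun z => F z - G z)%C (fun z => Phi z - Psi z)%C.
Proof. intros H1 H2 z Hz; apply is_Cderive_minus; [now apply H1|now apply H2]. Qed.

Lemma is_primitive_ext (F G Phi : C -> C) :
  (forall z, upper_half_plane z -> F z = G z) -> is_primitive F Phi -> is_primitive G Phi.
Proof. intros H H1 z Hz; rewrite <- H by assumption; now apply H1. Qed.

Lemma RtoC_neq_0 (x : R) : x <> 0 -> RtoC x <> 0%C.
Proof. intros H E; apply H; now injection E. Qed.

Lemma C_neq_real (z : C) (x : R) : upper_half_plane z -> (z - RtoC x)%C <> 0%C.
Proof.
unfold upper_half_plane; intros H E; apply (f_equal Im) in E; destruct z; simpl in *; lra.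
Qed.

Definition mob_den (A : mat2) (z : C) : C := (ZtoC (m21 A) * z + ZtoC (m22 A))%C.

Lemma in_SL2Z_IZR (A : mat2) :
  in_SL2Z A -> IZR (m11 A) * IZR (m22 A) - IZR (m12 A) * IZR (m21 A) = 1.
Proof. unfold in_SL2Z, mdet; intros H; rewrite <- !mult_IZR, <- minus_IZR, H; reflexivity. Qed.

Lemma mob_den_neq_0 (A : mat2) (z : C) :
  in_SL2Z A -> upper_half_plane z -> mob_den A z <> 0%C.
Proof.
unfold upper_half_plane; intros HA Hz E; apply in_SL2Z_IZR in HA.
unfold mob_den, ZtoC in E.
assert (E1 := f_equal Re E); assert (E2 := f_equal Im E).
destruct z as [x y]; simpl in *.
assert (Hc : IZR (m21 A) = 0) by nra.
rewrite Hc in *; nra.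
Qed.

Lemma mobius_upper_half_plane (A : mat2) (z : C) :
  in_SL2Z A -> upper_half_plane z -> upper_half_plane (mobius A z).
Proof.
intros HA Hz; assert (Hd := mob_den_neq_0 A z HA Hz); apply in_SL2Z_IZR in HA.
assert (Hn : 0 < Cmod (mob_den A z) ^ 2) by (apply pow_lt; now apply Cmod_gt_0).
rewrite Cmod2_alt in Hn.
unfold upper_half_plane, mobius, mob_den, ZtoC in *; destruct z as [x y]; simpl in *.
match goal with |- 0 < ?e =>
  replace e with ((IZR (m11 A) * IZR (m22 A) - IZR (m12 A) * IZR (m21 A)) * y /
    ((IZR (m21 A) * x + IZR (m22 A)) ^ 2 + (IZR (m21 A) * y) ^ 2)) end.
- rewrite HA; apply Rdiv_lt_0_compat; [lra|nra].
- field; nra.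
Qed.

Lemma is_Cderive_mobius (A : mat2) (z : C) :
  in_SL2Z A -> upper_half_plane z ->
  is_Cderive (mobius A) z (/ (mob_den A z * mob_den A z))%C.
Proof.
intros HA Hz; assert (Hd := mob_den_neq_0 A z HA Hz).
apply in_SL2Z_IZR in HA; apply (f_equal RtoC) in HA.
rewrite RtoC_minus, !RtoC_mult in HA.
eapply is_Cderive_ext_val; [|apply (is_Cderive_mult
  (fun t => ZtoC (m11 A) * t + ZtoC (m12 A))%C (fun t => / mob_den A t)%C);
  [apply is_Cderive_linear|apply is_Cderive_comp; [now apply is_Cderive_inv|apply is_Cderive_linear]]].
cbv beta; symmetry; unfold mob_den, ZtoC in *.
transitivity ((RtoC (IZR (m11 A)) * RtoC (IZR (m22 A)) - RtoC (IZR (m12 A)) * RtoC (IZR (m21 A)))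
  * / ((RtoC (IZR (m21 A)) * z + RtoC (IZR (m22 A))) * (RtoC (IZR (m21 A)) * z + RtoC (IZR (m22 A)))))%C.
  rewrite HA; ring.
field; assumption.
Qed.

Lemma mdet_mmul (A B : mat2) : mdet (mmul A B) = (mdet A * mdet B)%Z.
Proof. unfold mdet, mmul; simpl; ring. Qed.

Lemma in_SL2Z_mmul (A B : mat2) : in_SL2Z A -> in_SL2Z B -> in_SL2Z (mmul A B).
Proof. unfold in_SL2Z; intros HA HB; rewrite mdet_mmul, HA, HB; reflexivity. Qed.

Lemma mob_den_mmul (A B : mat2) (z : C) : in_SL2Z B -> upper_half_plane z ->
  mob_den (mmul A B) z = (mob_den A (mobius B z) * mob_den B z)%C.
Proof.
intros HB Hz; assert (Hd := mob_den_neq_0 B z HB Hz).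
unfold mobius, mob_den, ZtoC in *; simpl.
rewrite !plus_IZR, !mult_IZR, !RtoC_plus, !RtoC_mult; field; assumption.
Qed.

Lemma mobius_mmul (A B : mat2) (z : C) : in_SL2Z A -> in_SL2Z B -> upper_half_plane z ->
  mobius (mmul A B) z = mobius A (mobius B z).
Proof.
intros HA HB Hz.
assert (Hd := mob_den_neq_0 B z HB Hz).
assert (Hd2 := mob_den_neq_0 A _ HA (mobius_upper_half_plane B z HB Hz)).
assert (Hd3 := mob_den_neq_0 _ z (in_SL2Z_mmul A B HA HB) Hz).
assert (E := mob_den_mmul A B z HB Hz).
unfold mobius at 1 2; fold (mob_den (mmul A B) z); fold (mob_den A (mobius B z)).
rewrite E in *.
assert (E2 : (ZtoC (m11 (mmul A B)) * z + ZtoC (m12 (mmul A B)) =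
  (ZtoC (m11 A) * mobius B z + ZtoC (m12 A)) * mob_den B z)%C).
  unfold mobius; fold (mob_den B z); unfold mob_den, ZtoC in *; simpl.
  rewrite !plus_IZR, !mult_IZR, !RtoC_plus, !RtoC_mult; field; assumption.
rewrite E2; field; split; assumption.
Qed.

(** Makes sense for any two real points, not only for fixed points of a matrix, so that kernels can
    be moved by matrices and compared across words. *)
Definition kernel (w z : R) (t : C) : C := (/ (t - RtoC w) - / (t - RtoC z))%C.

(** The pullback of the differential form [k(t) dt]: for determinant 1 the derivative of [mobius A]
    is the inverse square of [mob_den A]. *)
Definition pullback (A : mat2) (k : C -> C) (t : C) : C :=
  (k (mobius A t) * / (mob_den A t * mob_den A t))%C.

Lemma mobius_minus (A : mat2) (t : C) (w : R) :
  in_SL2Z A -> upper_half_plane t -> IZR (m21 A) * w + IZR (m22 A) <> 0 ->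
  ((mobius A t - RtoC (mobiusR A w)) * (mob_den A t * RtoC (IZR (m21 A) * w + IZR (m22 A)))
   = t - RtoC w)%C.
Proof.
intros HA Ht Hw.
assert (Hd := mob_den_neq_0 A t HA Ht).
apply in_SL2Z_IZR in HA; apply (f_equal RtoC) in HA.
rewrite RtoC_minus, !RtoC_mult in HA.
apply RtoC_neq_0 in Hw as Hw'.
unfold mobius, mobiusR, mob_den, ZtoC in *.
rewrite RtoC_div, !RtoC_plus, !RtoC_mult in * by assumption.
transitivity ((RtoC (IZR (m11 A)) * RtoC (IZR (m22 A)) - RtoC (IZR (m12 A)) * RtoC (IZR (m21 A)))
  * (t - RtoC w))%C; [|rewrite HA; ring].
field; split; assumption.
Qed.

(** Each single term [1 / (t - w)] picks up the correction [- m21 A / mob_den A t]. It does not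
    depend on [w], so it cancels in the difference. *)
Lemma pullback_kernel (A : mat2) (w z : R) (t : C) :
  in_SL2Z A -> upper_half_plane t ->
  IZR (m21 A) * w + IZR (m22 A) <> 0 -> IZR (m21 A) * z + IZR (m22 A) <> 0 ->
  pullback A (kernel (mobiusR A w) (mobiusR A z)) t = kernel w z t.
Proof.
intros HA Ht Hw Hz.
assert (Hd := mob_den_neq_0 A t HA Ht).
assert (HAt := mobius_upper_half_plane A t HA Ht).
assert (E : forall u : R, IZR (m21 A) * u + IZR (m22 A) <> 0 ->
  (/ (mobius A t - RtoC (mobiusR A u)) * / (mob_den A t * mob_den A t))%C =
  (/ (t - RtoC u) - ZtoC (m21 A) * / mob_den A t)%C).
{ intros u Hu.
  assert (E := mobius_minus A t u HA Ht Hu).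
  assert (Hu' := RtoC_neq_0 _ Hu).
  assert (H1 := C_neq_real t u Ht).
  assert (H2 := C_neq_real _ (mobiusR A u) HAt).
  replace (/ (mobius A t - RtoC (mobiusR A u)))%C
    with (mob_den A t * RtoC (IZR (m21 A) * u + IZR (m22 A)) * / (t - RtoC u))%C.
  2: { rewrite <- E; field; repeat split; assumption. }
  rewrite RtoC_plus, RtoC_mult; unfold mob_den, ZtoC in *.
  field; split; assumption. }
unfold pullback, kernel.
transitivity (/ (mobius A t - RtoC (mobiusR A w)) * / (mob_den A t * mob_den A t) -
  / (mobius A t - RtoC (mobiusR A z)) * / (mob_den A t * mob_den A t))%C; [ring|].
rewrite !E by assumption; ring.
Qed.

Lemma holomorphic_kernel (w z : R) : holomorphic (kernel w z).
Proof.
intros t Ht.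
assert (H : forall u : R, is_Cderive (fun s => / (s - RtoC u))%C t
   (- / ((t - RtoC u) * (t - RtoC u)) * (1 - 0))%C).
  intros u; apply (is_Cderive_comp Cinv).
    apply is_Cderive_inv; now apply C_neq_real.
  apply is_Cderive_minus; [apply is_Cderive_id|apply is_Cderive_const].
eexists; apply is_Cderive_minus; apply H.
Qed.

Lemma weakly_holomorphic_modular_holomorphic (f : C -> C) :
  weakly_holomorphic_modular f -> holomorphic f.
Proof. intros [H _]; exact H. Qed.

(** By the modularity of [f], an increment of [Phi] over a translate of the arc is an increment over
    the arc itself, with the kernel pulled back. *)
Lemma is_primitive_pullback (f k Phi : C -> C) (A : mat2) :
  weakly_holomorphic_modular f -> in_SL2Z A ->
  is_primitive (fun t => f t * k t)%C Phi ->
  is_primitive (fun t => f t * pullback A k t)%C (fun t => Phi (mobius A t)).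
Proof.
intros [_ [Hf _]] HA HPhi t Ht.
eapply is_Cderive_ext_val; [|apply is_Cderive_comp;
  [apply HPhi; now apply mobius_upper_half_plane|now apply is_Cderive_mobius]].
unfold pullback; rewrite Hf by assumption; ring.
Qed.

(** * The arc of the unit circle as a path of integration *)

Definition arc (t : R) : C := (cos t, sin t).

Lemma Cexp_Ci (t : R) : Cexp (Ci * RtoC t)%C = arc t.
Proof.
unfold Cexp, arc; simpl.
replace (0 * t - 1 * 0) with 0 by ring; replace (0 * 0 + 1 * t) with t by ring.
rewrite exp_0; f_equal; ring.
Qed.

Lemma arc_upper_half_plane (t : R) : PI / 3 <= t <= 2 * PI / 3 -> upper_half_plane (arc t).
Proof.
intros Ht; assert (H := PI_RGT_0); unfold upper_half_plane; simpl; apply sin_gt_0; lra.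
Qed.

Lemma is_path_derive_arc (t : R) : is_path_derive arc t (Ci * arc t)%C.
Proof.
replace (Ci * arc t)%C with ((- sin t, cos t) : C)
  by (unfold arc, Ci, Cmult; simpl; f_equal; ring).
apply is_path_derive_eps; intros e He.
assert (He2 : 0 < e / 2) by lra.
assert (Hc := proj2 (is_derive_Reals cos t (- sin t)) (derivable_pt_lim_cos t)).
assert (Hs := proj2 (is_derive_Reals sin t (cos t)) (derivable_pt_lim_sin t)).
destruct Hc as [_ Hc], Hs as [_ Hs].
destruct (Hc t (fun P h => h) (mkposreal _ He2)) as [d1 Hd1].
destruct (Hs t (fun P h => h) (mkposreal _ He2)) as [d2 Hd2].
exists (Rmin d1 d2); split; [apply Rmin_pos; apply cond_pos|]; intros s Hst.
assert (H1 := Hd1 s (Rlt_le_trans _ _ _ Hst (Rmin_l _ _))).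
assert (H2 := Hd2 s (Rlt_le_trans _ _ _ Hst (Rmin_r _ _))).
change (Rabs (cos s - cos t - (s - t) * - sin t) <= e / 2 * Rabs (s - t)) in H1.
change (Rabs (sin s - sin t - (s - t) * cos t) <= e / 2 * Rabs (s - t)) in H2.
eapply Rle_trans; [apply Cmod_le_Re_Im|].
replace (Re (arc s - arc t - RtoC (s - t) * (- sin t, cos t)%R)%C)
  with (cos s - cos t - (s - t) * - sin t) by (simpl; ring).
replace (Im (arc s - arc t - RtoC (s - t) * (- sin t, cos t)%R)%C)
  with (sin s - sin t - (s - t) * cos t) by (simpl; ring).
lra.
Qed.

(** [arc] is an integral curve of the field [z -> Ci * z], of speed 1 and length [PI / 3]. The
    increment runs from [rho2] to its image under a letter, against the parameter [t]. *)
Lemma primitive_arc_bound (F Phi : C -> C) (m : R) :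
  holomorphic F -> is_primitive F Phi ->
  (forall t, PI / 3 <= t <= 2 * PI / 3 -> Cmod (F (arc t)) <= m) ->
  Cmod (Phi (arc (PI / 3)) - Phi (arc (2 * PI / 3))) <= m * (PI / 3).
Proof.
intros HF HPhi Hm.
assert (Hpi := PI_RGT_0).
assert (Hk : holomorphic (fun z => Ci * z)%C).
  intros z Hz; destruct (holomorphic_linear Ci 0 z Hz) as [l Hl]; exists l.
  revert Hl; apply is_derive_ext; intros y; change (Ci * y + 0 = Ci * y)%C; ring.
assert (H := is_RInt_primitive F Phi (fun z => Ci * z)%C arc (PI / 3) (2 * PI / 3)
  HF HPhi Hk ltac:(lra) arc_upper_half_plane (fun t _ => is_path_derive_arc t)).
rewrite Cmod_minus_sym.
replace (m * (PI / 3)) with (m * (2 * PI / 3 - PI / 3)) by field.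
apply (Cmod_is_RInt_le (fun t => F (arc t) * (Ci * arc t))%C); [lra| |exact H].
intros t Ht; rewrite !Cmod_mult, Cmod_Ci.
replace (Cmod (arc t)) with 1; [rewrite !Rmult_1_r; now apply Hm|].
unfold Cmod, arc; simpl.
replace (cos t * (cos t * 1) + sin t * (sin t * 1)) with 1; [now rewrite sqrt_1|].
assert (E := sin2_cos2 t); unfold Rsqr in E; lra.
Qed.

(** * Nonnegative matrices and chordal lengths *)

Definition nonneg (A : mat2) : Prop :=
  (0 <= m11 A /\ 0 <= m12 A /\ 0 <= m21 A /\ 0 <= m22 A)%Z /\ in_SL2Z A.

(** For nonnegative matrices this is equivalent to hyperbolicity, and in contrast to the trace
    condition it visibly passes to products. *)
Definition positive (A : mat2) : Prop :=
  nonneg A /\ (0 < m12 A /\ 0 < m21 A)%Z.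

(* [mrev A = J A^(-1) J] with [J = diag (-1, 1)], so that [A^(-1)] acts on [- x] as [mrev A] acts
   on [x > 0]; on words in [T] and [V] it reverses the order of the letters. *)
Definition mrev (A : mat2) : mat2 := Mat2 (m22 A) (m12 A) (m21 A) (m11 A).

Lemma nonneg_diag (A : mat2) : nonneg A -> (0 < m11 A /\ 0 < m22 A)%Z.
Proof. unfold nonneg, in_SL2Z, mdet; intros; nia. Qed.

Lemma nonneg_mone : nonneg mone.
Proof. repeat split; simpl; lia. Qed.

Lemma nonneg_mmul (A B : mat2) : nonneg A -> nonneg B -> nonneg (mmul A B).
Proof.
intros [HA DA] [HB DB]; split; [|now apply in_SL2Z_mmul].
unfold mmul; simpl; repeat split; apply Z.add_nonneg_nonneg; apply Z.mul_nonneg_nonneg; lia.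
Qed.

Lemma mrev_mmul (A B : mat2) : mrev (mmul A B) = mmul (mrev B) (mrev A).
Proof. unfold mrev, mmul; simpl; f_equal; ring. Qed.

Lemma nonneg_mrev (A : mat2) : nonneg A -> nonneg (mrev A).
Proof. unfold nonneg, in_SL2Z, mdet; simpl; intros; repeat split; lia. Qed.

Lemma positive_mrev (A : mat2) : positive A -> positive (mrev A).
Proof. intros [H1 H2]; split; [now apply nonneg_mrev|exact H2]. Qed.

Lemma m12_mmul_pos (A B : mat2) : nonneg A -> nonneg B ->
  (0 < m12 A \/ 0 < m12 B)%Z -> (0 < m12 (mmul A B))%Z.
Proof.
intros HA HB; assert (H1 := nonneg_diag A HA); assert (H2 := nonneg_diag B HB).
destruct HA as [HA _], HB as [HB _]; simpl; nia.
Qed.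

Lemma m21_mmul_pos (A B : mat2) : nonneg A -> nonneg B ->
  (0 < m21 A \/ 0 < m21 B)%Z -> (0 < m21 (mmul A B))%Z.
Proof.
intros HA HB; assert (H1 := nonneg_diag A HA); assert (H2 := nonneg_diag B HB).
destruct HA as [HA _], HB as [HB _]; simpl; nia.
Qed.

Lemma positive_mmul_l (A B : mat2) : positive A -> nonneg B -> positive (mmul A B).
Proof.
intros [HA [H1 H2]] HB; split; [now apply nonneg_mmul|].
split; [apply m12_mmul_pos|apply m21_mmul_pos]; auto.
Qed.

Lemma positive_mmul_r (A B : mat2) : nonneg A -> positive B -> positive (mmul A B).
Proof.
intros HA [HB [H1 H2]]; split; [now apply nonneg_mmul|].
split; [apply m12_mmul_pos|apply m21_mmul_pos]; auto.
Qed.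

(** If an off-diagonal entry vanishes, determinant 1 forces both diagonal entries to be 1 and the
    trace to be 2. *)
Lemma hyperbolic_positive (A : mat2) : nonneg A -> hyperbolic A -> positive A.
Proof.
intros HA H; split; [exact HA|].
assert (H1 := nonneg_diag A HA).
destruct HA as [HA D]; unfold hyperbolic, mtr, in_SL2Z, mdet in *; nia.
Qed.

Lemma positive_hyperbolic (A : mat2) : positive A -> hyperbolic A.
Proof.
intros [HA P]; assert (H1 := nonneg_diag A HA).
destruct HA as [HA D]; unfold hyperbolic, mtr, in_SL2Z, mdet in *; nia.
Qed.

(* Bounds, up to a factor, the chordal length of the interval [A (0, oo)]. *)
Definition chord (A : mat2) : R :=
  4 / (IZR (m11 A + m21 A) * IZR (m12 A + m22 A)).

Lemma nonneg_columns (A : mat2) : nonneg A ->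
  1 <= IZR (m11 A + m21 A) /\ 1 <= IZR (m12 A + m22 A).
Proof.
intros HA; assert (H1 := nonneg_diag A HA); destruct HA as [HA _].
split; apply IZR_le; lia.
Qed.

Lemma chord_le (A : mat2) : nonneg A -> 0 <= chord A <= 4.
Proof.
intros HA; destruct (nonneg_columns A HA) as [H1 H2]; unfold chord.
set (p := IZR (m11 A + _)) in *; set (q := IZR (m12 A + _)) in *.
assert (1 <= p * q) by nra.
split.
- apply Rmult_le_pos; [lra|]; left; apply Rinv_0_lt_compat; lra.
- replace 4 with (4 / 1) at 2 by field; apply Rmult_le_compat_l; [lra|].
  apply Rinv_le_contravar; lra.
Qed.

(** All entries of [U] are at least 1, so its column sums are at least 2, and both column sums of
    [W] at least double. *)
Lemma chord_mmul (U W : mat2) : positive U -> nonneg W -> chord (mmul U W) <= chord W / 4.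
Proof.
intros [HU PU] HW.
assert (HU1 := nonneg_diag U HU); assert (HW1 := nonneg_diag W HW).
destruct (nonneg_columns W HW) as [H1 H2].
destruct HU as [HU _], HW as [HW _].
assert (E : forall u v, (0 <= u -> 0 <= v ->
    2 * (u + v) <= (m11 U * u + m12 U * v) + (m21 U * u + m22 U * v))%Z).
  intros u v Hu Hv.
  assert (0 <= (m11 U + m21 U - 2) * u)%Z by (apply Z.mul_nonneg_nonneg; lia).
  assert (0 <= (m12 U + m22 U - 2) * v)%Z by (apply Z.mul_nonneg_nonneg; lia).
  lia.
assert (E1 : 2 * IZR (m11 W + m21 W) <= IZR (m11 (mmul U W) + m21 (mmul U W)))
  by (rewrite <- mult_IZR; apply IZR_le, E; lia).
assert (E2 : 2 * IZR (m12 W + m22 W) <= IZR (m12 (mmul U W) + m22 (mmul U W)))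
  by (rewrite <- mult_IZR; apply IZR_le, E; lia).
unfold chord.
set (p := IZR (m11 W + m21 W)) in *; set (q := IZR (m12 W + m22 W)) in *.
set (p' := IZR (m11 _ + _)) in *; set (q' := IZR (m12 _ + _)) in *.
replace (4 / (p * q) / 4) with (4 / (2 * p * (2 * q))) by (field; lra).
apply Rmult_le_compat_l; [lra|].
apply Rinv_le_contravar; [repeat apply Rmult_lt_0_compat; lra|apply Rmult_le_compat; lra].
Qed.

Lemma nonneg_IZR (A : mat2) : nonneg A ->
  0 < IZR (m11 A) /\ 0 <= IZR (m12 A) /\ 0 <= IZR (m21 A) /\ 0 < IZR (m22 A).
Proof.
intros HA; destruct (nonneg_diag A HA); destruct HA as [HA _].
repeat split; try (apply IZR_lt; lia); apply IZR_le; lia.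
Qed.

Lemma mobiusR_pos (A : mat2) (x : R) : nonneg A -> 0 < x -> 0 < mobiusR A x.
Proof.
intros HA Hx; destruct (nonneg_IZR A HA) as (H1 & H2 & H3 & H4).
unfold mobiusR; apply Rdiv_lt_0_compat; nra.
Qed.

Lemma mobiusR_mmul (A B : mat2) (x : R) : nonneg A -> nonneg B -> 0 < x ->
  mobiusR (mmul A B) x = mobiusR A (mobiusR B x).
Proof.
intros HA HB Hx.
assert (HBx := mobiusR_pos B x HB Hx).
destruct (nonneg_IZR A HA) as (H1 & H2 & H3 & H4).
destruct (nonneg_IZR B HB) as (K1 & K2 & K3 & K4).
assert (E1 : 0 < IZR (m21 B) * x + IZR (m22 B)) by nra.
assert (E2 : 0 < IZR (m21 A) * mobiusR B x + IZR (m22 A)) by nra.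
unfold mobiusR in *; simpl; rewrite !plus_IZR, !mult_IZR.
assert (E3 : 0 < IZR (m21 A) * (IZR (m11 B) * x + IZR (m12 B)) +
   IZR (m22 A) * (IZR (m21 B) * x + IZR (m22 B))).
  apply (Rmult_lt_compat_r _ _ _ E1) in E2.
  match goal with |- 0 < ?e => match type of E2 with _ < ?e' =>
    replace e with e' by (field; lra) end end; lra.
field; lra.
Qed.

(** By determinant 1 the denominator is the inverse of [m21 A * x + m11 A], which is positive. Hence
    the inverse of [A] moves the negative pole [- x] without ever meeting infinity. *)
Lemma mobiusR_mrev (A : mat2) (x : R) : nonneg A -> 0 < x ->
  IZR (m21 A) * - mobiusR (mrev A) x + IZR (m22 A) <> 0 /\
  mobiusR A (- mobiusR (mrev A) x) = - x.
Proof.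
intros HA Hx; destruct (nonneg_IZR A HA) as (H1 & H2 & H3 & H4).
assert (D := in_SL2Z_IZR A (proj2 HA)).
assert (E : 0 < IZR (m21 A) * x + IZR (m11 A)) by nra.
assert (Ed : IZR (m21 A) * - mobiusR (mrev A) x + IZR (m22 A) = / (IZR (m21 A) * x + IZR (m11 A))).
  unfold mobiusR; simpl; rewrite <- (Rmult_1_l (/ _)), <- D; field; lra.
assert (En : IZR (m11 A) * - mobiusR (mrev A) x + IZR (m12 A)
   = - x * / (IZR (m21 A) * x + IZR (m11 A))).
  unfold mobiusR; simpl.
  transitivity (- x * (IZR (m11 A) * IZR (m22 A) - IZR (m12 A) * IZR (m21 A)) *
    / (IZR (m21 A) * x + IZR (m11 A))); [field; lra|rewrite D; ring].
split.
- rewrite Ed; apply Rinv_neq_0_compat; lra.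
- unfold mobiusR at 1; rewrite Ed, En; field; lra.
Qed.

(** * Size of the kernels on the arc *)

Lemma cos_arc (t : R) : PI / 3 <= t <= 2 * PI / 3 -> - (1 / 2) <= cos t <= 1 / 2.
Proof.
intros Ht; assert (H := PI_RGT_0); split.
- replace (- (1 / 2)) with (cos (2 * (PI / 3))) by (rewrite cos_2PI3; field).
  apply cos_decr_1; lra.
- rewrite <- cos_PI3; apply cos_decr_1; lra.
Qed.

(** With [r = |x|], the squared modulus is at least [1 - r + r^2], which exceeds [(1 + r)^2 / 4] by
    [3/4 (r - 1)^2]. *)
Lemma Cmod_arc_minus (t x : R) : PI / 3 <= t <= 2 * PI / 3 ->
  (1 + Rabs x) / 2 <= Cmod (arc t - RtoC x).
Proof.
intros Ht; assert (Hc := cos_arc t Ht); assert (Hx := Rabs_pos x).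
apply Rsqr_incr_0_var; [|apply Cmod_ge_0]; unfold Rsqr.
replace (Cmod (arc t - RtoC x) * Cmod (arc t - RtoC x))
  with (Cmod (arc t - RtoC x) ^ 2) by ring.
rewrite Cmod2_alt; unfold arc; simpl.
assert (E := sin2_cos2 t); unfold Rsqr in E.
assert (Hx2 : Rabs x * Rabs x = x * x)
  by (rewrite <- Rabs_mult; apply Rabs_pos_eq; nra).
assert (Hm : x * cos t <= Rabs x * (1 / 2)).
  eapply Rle_trans; [apply Rle_abs|]; rewrite Rabs_mult.
  apply Rmult_le_compat_l; [lra|]; apply Rabs_le_between; lra.
assert (0 <= (Rabs x - 1) * (Rabs x - 1)) by apply Rle_0_sqr.
nra.
Qed.

Lemma Cmod_inv_arc_minus (t x : R) : PI / 3 <= t <= 2 * PI / 3 ->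
  Cmod (/ (arc t - RtoC x)) <= 2 / (1 + Rabs x).
Proof.
intros Ht; assert (H := Cmod_arc_minus t x Ht); assert (Hx := Rabs_pos x).
rewrite Cmod_inv by (apply C_neq_real; now apply arc_upper_half_plane).
replace (2 / (1 + Rabs x)) with (/ ((1 + Rabs x) / 2)) by (field; lra).
apply Rinv_le_contravar; lra.
Qed.

(** The crude bound, for words too short to be hyperbolic for sure. *)
Lemma kernel_arc_bound (t x y : R) : PI / 3 <= t <= 2 * PI / 3 -> Cmod (kernel x y (arc t)) <= 4.
Proof.
intros Ht; unfold kernel, Cminus at 1; eapply Rle_trans; [apply Cmod_triangle|].
rewrite Cmod_opp.
assert (E : forall u, Cmod (/ (arc t - RtoC u)) <= 2).
  intros u; eapply Rle_trans; [now apply Cmod_inv_arc_minus|].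
  assert (Hu := Rabs_pos u).
  replace 2 with (2 * / 1) at 2 by field; apply Rmult_le_compat_l; [lra|].
  apply Rinv_le_contravar; lra.
assert (Ex := E x); assert (Ey := E y); lra.
Qed.

(** The kernel equals [(x - y) / ((t - x) (t - y))]; the bound is, up to a constant, the chordal
    distance of the two poles. *)
Lemma kernel_arc_bound_chordal (t x y : R) : PI / 3 <= t <= 2 * PI / 3 ->
  Cmod (kernel x y (arc t)) <= 4 * Rabs (x - y) / ((1 + Rabs x) * (1 + Rabs y)).
Proof.
intros Ht.
assert (Ha := arc_upper_half_plane t Ht).
assert (Hx := Rabs_pos x); assert (Hy := Rabs_pos y).
replace (kernel x y (arc t)) with (RtoC (x - y) * (/ (arc t - RtoC x) * / (arc t - RtoC y)))%C.
2: { unfold kernel; rewrite RtoC_minus; field; split; now apply C_neq_real. }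
rewrite !Cmod_mult, Cmod_R.
replace (4 * Rabs (x - y) / ((1 + Rabs x) * (1 + Rabs y)))
  with (Rabs (x - y) * (2 / (1 + Rabs x) * (2 / (1 + Rabs y)))) by (field; lra).
apply Rmult_le_compat_l; [apply Rabs_pos|].
apply Rmult_le_compat; try apply Cmod_ge_0; now apply Cmod_inv_arc_minus.
Qed.

(** With column sums [p], [q] the factors [c x + d], [c y + d] cancel and leave
    [4 |x - y| / ((p x + q) (p y + q))]. The denominator is at least [p q (x + y)], and
    [|x - y| <= x + y]. *)
Lemma mobiusR_chord (A : mat2) (x y : R) : nonneg A -> 0 < x -> 0 < y ->
  4 * Rabs (mobiusR A x - mobiusR A y) /
    ((1 + Rabs (mobiusR A x)) * (1 + Rabs (mobiusR A y))) <= chord A.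
Proof.
intros HA Hx Hy.
rewrite (Rabs_pos_eq (mobiusR A x)), (Rabs_pos_eq (mobiusR A y))
  by (left; now apply mobiusR_pos).
assert (D := in_SL2Z_IZR A (proj2 HA)).
destruct (nonneg_IZR A HA) as (H1 & H2 & H3 & H4).
destruct (nonneg_columns A HA) as [P1 Q1].
unfold chord, mobiusR; rewrite plus_IZR in *.
rewrite plus_IZR in *.
set (a := IZR (m11 A)) in *; set (b := IZR (m12 A)) in *.
set (c := IZR (m21 A)) in *; set (d := IZR (m22 A)) in *.
assert (Ex : 0 < c * x + d) by nra.
assert (Ey : 0 < c * y + d) by nra.
assert (Sx : 0 < (a + c) * x + (b + d)) by nra.
assert (Sy : 0 < (a + c) * y + (b + d)) by nra.
replace ((a * x + b) / (c * x + d) - (a * y + b) / (c * y + d))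
  with ((x - y) / ((c * x + d) * (c * y + d))).
2: { transitivity ((x - y) * (a * d - b * c) / ((c * x + d) * (c * y + d)));
     [rewrite D|]; field; lra. }
rewrite Rabs_div, (Rabs_pos_eq (_ * _)) by nra.
replace (4 * (Rabs (x - y) / ((c * x + d) * (c * y + d))) /
   ((1 + (a * x + b) / (c * x + d)) * (1 + (a * y + b) / (c * y + d))))
  with (4 * Rabs (x - y) / (((a + c) * x + (b + d)) * ((a + c) * y + (b + d)))).
2: { field; repeat split; nra. }
assert (Hxy : Rabs (x - y) <= x + y) by (apply Rabs_le_between; lra).
set (p := a + c) in *; set (q := b + d) in *.
assert (Hpq : 0 < p * q) by nra.
apply Rle_div_l; [nra|].
replace (4 / (p * q) * ((p * x + q) * (p * y + q)))
  with (4 * ((p * x + q) * (p * y + q) / (p * q))) by (field; lra).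
apply Rmult_le_compat_l; [lra|].
apply Rle_div_r; [nra|].
apply Rle_trans with ((x + y) * (p * q)); [apply Rmult_le_compat_r; lra|].
assert (0 <= p * p * (x * y)) by (repeat apply Rmult_le_pos; lra).
nra.
Qed.

Lemma kernel_opp_arc_bound (t x y : R) : PI / 3 <= t <= 2 * PI / 3 ->
  Cmod (kernel (- x) (- y) (arc t)) <= 4 * Rabs (x - y) / ((1 + Rabs x) * (1 + Rabs y)).
Proof.
intros Ht; rewrite <- (Rabs_Ropp (x - y)), <- (Rabs_Ropp x), <- (Rabs_Ropp y).
replace (- (x - y)) with (- x - - y) by ring; now apply kernel_arc_bound_chordal.
Qed.

(** * Finite sums with blockwise geometric decay *)

Fixpoint psum (h : nat -> R) (n : nat) : R :=
  match n with O => 0 | S n' => psum h n' + h n' end.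

Lemma psum_le (g h : nat -> R) (n : nat) :
  (forall k, (k < n)%nat -> g k <= h k) -> psum g n <= psum h n.
Proof.
induction n as [|n IH]; intros H; simpl; [lra|].
apply Rplus_le_compat; [apply IH; intros; apply H; lia|apply H; lia].
Qed.

Lemma psum_plus (g h : nat -> R) (n : nat) :
  psum (fun k => g k + h k) n = psum g n + psum h n.
Proof. induction n as [|n IH]; simpl; [ring|rewrite IH; ring]. Qed.

Lemma psum_const (a : R) (n : nat) : psum (fun _ => a) n = INR n * a.
Proof. induction n as [|n IH]; [simpl; ring|rewrite S_INR; simpl; rewrite IH; ring]. Qed.

Lemma psum_scal (a : R) (h : nat -> R) (n : nat) : psum (fun k => a * h k) n = a * psum h n.
Proof. induction n as [|n IH]; simpl; [ring|rewrite IH; ring]. Qed.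

Lemma psum_add (h : nat -> R) (m n : nat) :
  psum h (m + n) = psum h m + psum (fun k => h (m + k)%nat) n.
Proof.
induction n as [|n IH]; [rewrite Nat.add_0_r; simpl; ring|].
rewrite Nat.add_succ_r; simpl; rewrite IH; ring.
Qed.

Lemma psum_ext (g h : nat -> R) (n : nat) :
  (forall k, (k < n)%nat -> g k = h k) -> psum g n = psum h n.
Proof. intros H; apply Rle_antisym; apply psum_le; intros k Hk; rewrite H by lia; lra. Qed.

Lemma psum_rev (h : nat -> R) (n : nat) : psum (fun k => h (n - S k)%nat) n = psum h n.
Proof.
induction n as [|n IH]; [reflexivity|].
rewrite (psum_add _ 1 n : psum _ (S n) = _).
rewrite (psum_ext _ (fun k => h (n - S k)%nat) n) by reflexivity.
rewrite IH; simpl; rewrite Nat.sub_0_r; ring.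
Qed.

(** The first [N] terms sum to at most [N b], the others to at most a quarter of a shorter sum of
    the same kind; [4/3] solves [u = 1 + u / 4]. *)
Lemma psum_geometric (h : nat -> R) (b : R) (N : nat) : (0 < N)%nat -> 0 <= b ->
  forall n, (forall k, (k < n)%nat -> h k <= b) ->
  (forall k, (k + N < n)%nat -> h (k + N)%nat <= h k / 4) ->
  psum h n <= 4 / 3 * b * INR N.
Proof.
intros HN Hb n; induction n as [n IH] using (well_founded_induction lt_wf); intros H1 H2.
destruct (Nat.le_gt_cases n N) as [HnN|HnN].
- apply Rle_trans with (INR n * b).
    rewrite <- psum_const; now apply psum_le.
  apply le_INR in HnN; assert (0 <= INR n) by apply pos_INR; nra.
- replace n with (N + (n - N))%nat by lia; rewrite psum_add.
  assert (E1 : psum h N <= INR N * b)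
    by (rewrite <- psum_const; apply psum_le; intros k Hk; apply H1; lia).
  assert (E2 : psum (fun k => h (N + k)%nat) (n - N) <= / 4 * psum h (n - N)).
    rewrite <- psum_scal; apply psum_le; intros k Hk; rewrite Nat.add_comm.
    assert (E := H2 k ltac:(lia)); lra.
  assert (E3 : psum h (n - N) <= 4 / 3 * b * INR N)
    by (apply IH; [lia|intros; apply H1; lia|intros; apply H2; lia]).
  lra.
Qed.

(** * Words in [T] and [V] *)

Lemma mmul_assoc (A B C : mat2) : mmul A (mmul B C) = mmul (mmul A B) C.
Proof. unfold mmul; simpl; f_equal; ring. Qed.

Lemma mmul_1_l (A : mat2) : mmul mone A = A.
Proof. destruct A; cbv -[Z.add Z.mul]; f_equal; ring. Qed.

Lemma mmul_1_r (A : mat2) : mmul A mone = A.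
Proof. destruct A; cbv -[Z.add Z.mul]; f_equal; ring. Qed.

(** Identifies the matrix [B] of the theorem, given only by its product with [A n], as a subword. *)
Lemma mmul_cancel_l (A B B' : mat2) : in_SL2Z A -> mmul A B = mmul A B' -> B = B'.
Proof.
unfold in_SL2Z, mdet; intros D E.
set (A' := Mat2 (m22 A) (- m12 A) (- m21 A) (m11 A)).
assert (HA : mmul A' A = mone) by (destruct A; simpl in D; cbv -[Z.add Z.mul Z.opp]; f_equal; nia).
rewrite <- (mmul_1_l B), <- (mmul_1_l B'), <- HA, <- !mmul_assoc, E; reflexivity.
Qed.

Lemma mpow_comm (A : mat2) (n : nat) : mmul A (mpow A n) = mmul (mpow A n) A.
Proof.
induction n as [|n IH]; simpl; [now rewrite mmul_1_l, mmul_1_r|].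
now rewrite IH at 1; rewrite mmul_assoc.
Qed.

Definition tv (b : bool) : mat2 := if b then matT else matV.

(** Starting position and length are both free, so that prefixes, suffixes and the matrix [B] are
    all subwords of one infinite word [X]. *)
Fixpoint wprod (X : nat -> bool) (s l : nat) : mat2 :=
  match l with O => mone | S l' => mmul (tv (X s)) (wprod X (S s) l') end.

Lemma nonneg_tv (b : bool) : nonneg (tv b).
Proof. destruct b; repeat split; simpl; lia. Qed.

Lemma nonneg_wprod (X : nat -> bool) (l s : nat) : nonneg (wprod X s l).
Proof.
revert s; induction l as [|l IH]; intros s; [apply nonneg_mone|].
apply nonneg_mmul; [apply nonneg_tv|apply IH].
Qed.

Lemma wprod_add (X : nat -> bool) (l l' s : nat) :
  wprod X s (l + l') = mmul (wprod X s l) (wprod X (s + l) l').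
Proof.
revert s; induction l as [|l IH]; intros s; simpl; [now rewrite mmul_1_l, Nat.add_0_r|].
rewrite IH, mmul_assoc; now replace (S s + l)%nat with (s + S l)%nat by lia.
Qed.

Lemma wprod_S (X : nat -> bool) (l s : nat) :
  wprod X s (S l) = mmul (wprod X s l) (tv (X (s + l)%nat)).
Proof.
rewrite <- Nat.add_1_r, wprod_add; simpl; now rewrite mmul_1_r.
Qed.

Lemma wprod_has_T (X : nat -> bool) (l s r : nat) :
  (s <= r < s + l)%nat -> X r = true -> (0 < m12 (wprod X s l))%Z.
Proof.
intros Hr HX; replace l with ((r - s) + S (l - S (r - s)))%nat by lia.
rewrite wprod_add; apply m12_mmul_pos; try apply nonneg_wprod; right.
replace (s + (r - s))%nat with r by lia; simpl; rewrite HX.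
apply m12_mmul_pos; [apply nonneg_tv|apply nonneg_wprod|left; simpl; lia].
Qed.

Lemma wprod_has_V (X : nat -> bool) (l s r : nat) :
  (s <= r < s + l)%nat -> X r = false -> (0 < m21 (wprod X s l))%Z.
Proof.
intros Hr HX; replace l with ((r - s) + S (l - S (r - s)))%nat by lia.
rewrite wprod_add; apply m21_mmul_pos; try apply nonneg_wprod; right.
replace (s + (r - s))%nat with r by lia; simpl; rewrite HX.
apply m21_mmul_pos; [apply nonneg_tv|apply nonneg_wprod|left; simpl; lia].
Qed.

(** In this form any [N] consecutive letters contain both [T] and [V], which makes their product
    positive. *)
Definition runs_below (N : nat) (X : nat -> bool) : Prop :=
  forall p, exists r, (p < r < p + N)%nat /\ X r <> X p.

Lemma positive_wprod (X : nat -> bool) (N s l : nat) :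
  runs_below N X -> (N <= l)%nat -> positive (wprod X s l).
Proof.
intros HX Hl; destruct (HX s) as [r [Hr Hne]].
split; [apply nonneg_wprod|].
destruct (X s) eqn:E, (X r) eqn:E'; try easy; split.
- apply (wprod_has_T X l s s); [lia|assumption].
- apply (wprod_has_V X l s r); [lia|assumption].
- apply (wprod_has_T X l s r); [lia|assumption].
- apply (wprod_has_V X l s s); [lia|assumption].
Qed.

(** * From partial quotients to an infinite word *)

Section ContinuedFraction.

Variable x : R.
Hypothesis Hirr : irrational x.

Lemma irrational_inv_frac (y : R) : irrational y -> irrational (/ frac_part y) /\ 1 < / frac_part y.
Proof.
intros Hy.
assert (E : y = IZR (Int_part y) + frac_part y) by (unfold frac_part; ring).
destruct (base_fp y) as [H1 H2].
assert (H0 : frac_part y <> 0).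
  intros H; apply (Hy (Int_part y) 1%Z); [discriminate|].
  rewrite E at 1; rewrite H; field.
split.
- intros p q Hq H.
  assert (Hq' : IZR q <> 0) by (now apply eq_IZR_contrapositive).
  assert (Hp : IZR p <> 0).
    intros Hp; rewrite Hp in H; unfold Rdiv in H; rewrite Rmult_0_l in H.
    now apply (Rinv_neq_0_compat _ H0).
  apply (Hy (Int_part y * p + q)%Z p); [intros ->; now apply Hp|].
  rewrite plus_IZR, mult_IZR, E at 1.
  rewrite <- (Rinv_inv (frac_part y)), H; field; split; assumption.
- rewrite <- Rinv_1; apply Rinv_lt_contravar; lra.
Qed.

Lemma complete_quotient_irrational (i : nat) : irrational (complete_quotient x i).
Proof. induction i as [|i IH]; [exact Hirr|]; now apply irrational_inv_frac. Qed.

(** Only from the second partial quotient on: the first is 0 when [0 < x < 1]. *)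
Lemma partial_quotient_pos (i : nat) : (1 <= partial_quotient x (S i))%nat.
Proof.
unfold partial_quotient; simpl.
destruct (irrational_inv_frac _ (complete_quotient_irrational i)) as [_ H].
destruct (base_Int_part (/ frac_part (complete_quotient x i))) as [_ H1].
assert (0 < Int_part (/ frac_part (complete_quotient x i)))%Z by (apply lt_IZR; lra).
lia.
Qed.

Lemma quotient_sum_lt (i : nat) : (quotient_sum x (S i) < quotient_sum x (S (S i)))%nat.
Proof.
assert (H := partial_quotient_pos i).
change (quotient_sum x (S (S i))) with (quotient_sum x (S i) + partial_quotient x (S i))%nat; lia.
Qed.

Lemma quotient_sum_mono (i j : nat) : (i <= j)%nat -> (quotient_sum x i <= quotient_sum x j)%nat.
Proof. induction 1; [lia|simpl; lia]. Qed.

Lemma block_index (k : nat) : exists i, (quotient_sum x i <= k < quotient_sum x (S i))%nat.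
Proof.
induction k as [|k [i [H1 H2]]].
- destruct (Nat.eq_dec (quotient_sum x 1) 0) as [E|E].
  (* If the first partial quotient is 0, block 0 is empty and position 0 belongs to block 1. *)
  + exists 1%nat; assert (H := quotient_sum_lt 0); lia.
  + exists 0%nat; simpl in *; lia.
- destruct (Nat.lt_ge_cases (S k) (quotient_sum x (S i))) as [H|H].
  + exists i; lia.
  + exists (S i); assert (H3 := quotient_sum_lt i); lia.
Qed.

Lemma block_index_unique (k i j : nat) :
  (quotient_sum x i <= k < quotient_sum x (S i))%nat ->
  (quotient_sum x j <= k < quotient_sum x (S j))%nat -> i = j.
Proof.
intros Hi Hj; destruct (Nat.lt_trichotomy i j) as [H|[H|H]]; [|exact H|].
- assert (E := quotient_sum_mono (S i) j H); lia.
- assert (E := quotient_sum_mono (S j) i H); lia.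
Qed.

(** The letter at position [k] is given by the parity of the block containing [k]. The next block
    starts with the other letter after fewer than [N] steps, and this start is the witness for
    [runs_below]. *)
Lemma associated_sequence_word (A : nat -> mat2) (N : nat) :
  associated_sequence x A -> (forall i, (partial_quotient x i < N)%nat) ->
  exists X, runs_below N X /\ forall n, A n = wprod X 0 n.
Proof.
intros HA HN.
set (idx := fun k => epsilon (inhabits O)
  (fun i => (quotient_sum x i <= k < quotient_sum x (S i))%nat)).
assert (Hidx : forall k, (quotient_sum x (idx k) <= k < quotient_sum x (S (idx k)))%nat)
  by (intros k; exact (epsilon_spec (inhabits O)
        (fun i => (quotient_sum x i <= k < quotient_sum x (S i))%nat) (block_index k))).
exists (fun k => Nat.even (idx k)); split.
- intros p; exists (quotient_sum x (S (idx p))).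
  assert (H := Hidx p); split.
  + assert (HNp := HN (idx p)); simpl in *; lia.
  + rewrite (block_index_unique _ _ (S (idx p)) (Hidx _)) by
      (assert (E := quotient_sum_lt (idx p)); lia).
    rewrite Nat.even_succ, <- Nat.negb_even; now destruct (Nat.even (idx p)).
- induction n as [|n IH].
  + rewrite (HA 0%nat 0%nat (Nat.le_0_l _) : A 0%nat = _); reflexivity.
  + rewrite wprod_S, <- IH; simpl.
    assert (H := Hidx n); set (i := idx n) in *; simpl in H.
    assert (E : A n = mmul (block_product x i) (mpow (letter i) (n - quotient_sum x i)))
      by (rewrite <- HA by lia; f_equal; lia).
    replace (S n) with (quotient_sum x i + S (n - quotient_sum x i))%nat by lia.
    rewrite E, HA by lia; simpl; rewrite mpow_comm, mmul_assoc; reflexivity.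
Qed.

End ContinuedFraction.

(** * Cycle integrals *)

(** For the converse, a root at which the denominator vanished would make the numerator vanish too,
    against determinant 1. *)
Lemma fixed_point_quadratic (A : mat2) (u : R) : in_SL2Z A ->
  fixed_point A u <->
  IZR (m21 A) * u ^ 2 + (IZR (m22 A) - IZR (m11 A)) * u - IZR (m12 A) = 0.
Proof.
intros HA; apply in_SL2Z_IZR in HA; unfold fixed_point, mobiusR; split.
- intros [H1 H2].
  assert (E : IZR (m11 A) * u + IZR (m12 A) = u * (IZR (m21 A) * u + IZR (m22 A)))
    by (rewrite <- H2 at 2; field; assumption).
  lra.
- intros H.
  assert (H1 : IZR (m21 A) * u + IZR (m22 A) <> 0).
    intros E; assert (E2 : IZR (m11 A) * u + IZR (m12 A) = 0) by nra.
    assert (IZR (m22 A) * (IZR (m11 A) * u + IZR (m12 A))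
      - IZR (m12 A) * (IZR (m21 A) * u + IZR (m22 A)) = u) by nra.
    assert (u = 0) by nra; subst u; nra.
  split; [exact H1|].
  replace (IZR (m11 A) * u + IZR (m12 A)) with (u * (IZR (m21 A) * u + IZR (m22 A))) by lra.
  field; assumption.
Qed.

Lemma Derive_mobiusR (A : mat2) (u : R) : in_SL2Z A -> IZR (m21 A) * u + IZR (m22 A) <> 0 ->
  Derive (mobiusR A) u = / (IZR (m21 A) * u + IZR (m22 A)) ^ 2.
Proof.
intros HA Hu; apply in_SL2Z_IZR in HA; apply is_derive_unique.
unfold mobiusR; auto_derive; [assumption|].
transitivity ((IZR (m11 A) * IZR (m22 A) - IZR (m12 A) * IZR (m21 A))
  / (IZR (m21 A) * u + IZR (m22 A)) ^ 2); [field; assumption|rewrite HA; field; assumption].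
Qed.

(** The roots have opposite signs. At them [c u + d] takes the two eigenvalues of [A], inverse to
    each other, and the derivative is the inverse square, so the positive root attracts. Uniqueness
    serves to recognize the points hidden in the chosen [cycle_form]. *)
Lemma positive_fixed_points (A : mat2) : positive A ->
  exists w z, w < 0 < z /\ repelling A w /\ attracting A z /\
    (forall u, repelling A u -> u = w) /\ (forall u, attracting A u -> u = z).
Proof.
intros [HA [Pb Pc]].
destruct (nonneg_IZR A HA) as (H1 & _ & _ & H4).
apply IZR_lt in Pb, Pc.
assert (HS := proj2 HA); assert (D := in_SL2Z_IZR A HS).
assert (Hfix := fun u => fixed_point_quadratic A u HS).
assert (Hder := fun u => Derive_mobiusR A u HS).
unfold repelling, attracting.
set (a := IZR (m11 A)) in *; set (b := IZR (m12 A)) in *.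
set (c := IZR (m21 A)) in *; set (d := IZR (m22 A)) in *.
assert (Hbc : 0 < b * c) by now apply Rmult_lt_0_compat.
assert (Had := pow2_ge_0 (a - d)).
set (s := sqrt ((a - d) ^ 2 + 4 * b * c)).
assert (Hs : s * s = (a - d) ^ 2 + 4 * b * c) by (apply sqrt_sqrt; lra).
assert (Hs0 : 0 <= s) by apply sqrt_pos.
assert (Hs1 : Rabs (a - d) < s).
  apply Rsqr_incrst_0; [|apply Rabs_pos|assumption].
  rewrite <- Rsqr_abs; unfold Rsqr; nra.
apply Rabs_lt_between in Hs1.
exists ((a - d - s) / (2 * c)), ((a - d + s) / (2 * c)).
set (w := (a - d - s) / (2 * c)); set (z := (a - d + s) / (2 * c)).
assert (Ew : 2 * c * w = a - d - s) by (unfold w; field; lra).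
assert (Ez : 2 * c * z = a - d + s) by (unfold z; field; lra).
assert (Hw : w < 0) by nra.
assert (Hz : 0 < z) by nra.
assert (Hfac : forall u, c * u ^ 2 + (d - a) * u - b = c * (u - w) * (u - z)).
  intros u.
  replace (c * (u - w) * (u - z)) with ((2 * c * u - 2 * c * w) * (2 * c * u - 2 * c * z) / (4 * c))
    by (field; lra).
  rewrite Ew, Ez.
  replace ((2 * c * u - (a - d - s)) * (2 * c * u - (a - d + s)))
    with ((2 * c * u - (a - d)) ^ 2 - s * s) by ring.
  rewrite Hs; field; lra.
assert (Hprod : (c * w + d) * (c * z + d) = 1).
  assert ((2 * (c * w + d)) * (2 * (c * z + d)) = 4); [|lra].
  replace (2 * (c * w + d)) with (a + d - s) by lra.
  replace (2 * (c * z + d)) with (a + d + s) by lra.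
  nra.
assert (Hz1 : 1 < c * z + d).
  assert (H := nonneg_diag A HA); assert (1 <= d) by (apply IZR_le; lia); nra.
assert (Hw1 : 0 < c * w + d < 1) by (split; nra).
assert (Fw : fixed_point A w) by (apply Hfix; rewrite Hfac; ring).
assert (Fz : fixed_point A z) by (apply Hfix; rewrite Hfac; ring).
assert (Rw : 1 < Rabs (Derive (mobiusR A) w)).
  rewrite Hder by lra; rewrite Rabs_pos_eq.
    rewrite <- Rinv_1; apply Rinv_lt_contravar; [|]; nra.
  left; apply Rinv_0_lt_compat; nra.
assert (Az : Rabs (Derive (mobiusR A) z) < 1).
  rewrite Hder by lra; rewrite Rabs_pos_eq.
    rewrite <- Rinv_1; apply Rinv_lt_contravar; [|]; nra.
  left; apply Rinv_0_lt_compat; nra.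
assert (Huniq : forall u, fixed_point A u -> u = w \/ u = z).
  intros u Hu; apply Hfix in Hu; rewrite Hfac in Hu.
  apply Rmult_integral in Hu as [Hu|Hu]; [apply Rmult_integral in Hu as [Hu|Hu]|]; [lra|left; lra|right; lra].
split; [lra|]; split; [now split|]; split; [now split|]; split.
- intros u [Fu Ru]; destruct (Huniq u Fu) as [->| ->]; [reflexivity|lra].
- intros u [Fu Ru]; destruct (Huniq u Fu) as [->| ->]; [lra|reflexivity].
Qed.

Lemma qeval_real (Q : qform) (u : R) : qeval Q (RtoC u) (RtoC 1) =
  RtoC (IZR (qa Q) * u ^ 2 + IZR (qb Q) * u + IZR (qc Q)).
Proof.
unfold qeval, ZtoC; rewrite !RtoC_plus, !RtoC_mult, RtoC_pow; ring.
Qed.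

Lemma sign_neg (u : R) : u < 0 -> sign u = -1.
Proof. apply sign_eq_m1. Qed.

(** The fixed point equation divided by the gcd of its coefficients, with its sign reversed: since
    [w < z], the leading coefficient must be negative. *)
Lemma is_cycle_form_exists (A : mat2) : positive A -> exists Q, is_cycle_form A Q.
Proof.
intros HA; destruct (positive_fixed_points A HA) as (w & z & Hwz & Rw & Az & _).
destruct HA as [HA [Pb Pc]].
assert (Fw := proj1 (fixed_point_quadratic A w (proj2 HA)) (proj1 Rw)).
assert (Fz := proj1 (fixed_point_quadratic A z (proj2 HA)) (proj1 Az)).
set (e := (m11 A - m22 A)%Z).
set (g1 := Z.gcd e (m12 A)); set (g := Z.gcd (m21 A) g1).
assert (Hg : (0 < g)%Z).
  assert (H := Z.gcd_nonneg (m21 A) g1); fold g in H.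
  assert (g <> 0)%Z by (intros E; apply Z.gcd_eq_0_l in E; lia); lia.
assert (D1 : (g | m21 A)%Z) by apply Z.gcd_divide_l.
assert (D2 : (g | g1)%Z) by apply Z.gcd_divide_r.
assert (D3 : (g | e)%Z) by (eapply Z.divide_trans; [exact D2|apply Z.gcd_divide_l]).
assert (D4 : (g | m12 A)%Z) by (eapply Z.divide_trans; [exact D2|apply Z.gcd_divide_r]).
exists (QForm (- (m21 A / g)) (e / g) (m12 A / g)), w, z.
assert (E1 : IZR (m21 A) = IZR g * IZR (m21 A / g))
  by (rewrite <- mult_IZR, <- Z.divide_div_mul_exact, Z.mul_comm, Z.div_mul
      by (assumption || lia); reflexivity).
assert (E3 : IZR (m11 A) - IZR (m22 A) = IZR g * IZR (e / g))
  by (rewrite <- minus_IZR, <- mult_IZR, <- Z.divide_div_mul_exact, Z.mul_comm, Z.div_mul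
      by (assumption || lia); reflexivity).
assert (E4 : IZR (m12 A) = IZR g * IZR (m12 A / g))
  by (rewrite <- mult_IZR, <- Z.divide_div_mul_exact, Z.mul_comm, Z.div_mul
      by (assumption || lia); reflexivity).
assert (Hg' : 0 < IZR g) by now apply IZR_lt.
assert (Hroot : forall u, IZR (m21 A) * u ^ 2 + (IZR (m22 A) - IZR (m11 A)) * u - IZR (m12 A) = 0 ->
  qeval (QForm (- (m21 A / g)) (e / g) (m12 A / g)) (RtoC u) (RtoC 1) = RtoC 0).
  intros u Hu; rewrite qeval_real; simpl; f_equal; rewrite opp_IZR.
  apply (Rmult_eq_reg_l (IZR g)); [|lra]; nra.
split; [exact Rw|]; split; [exact Az|]; split; [|split; [|split]].
- unfold primitive; simpl; rewrite Z.gcd_opp_l.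
  rewrite (Z.gcd_div_factor e (m12 A) g Hg D3 D4); fold g1.
  rewrite (Z.gcd_div_factor (m21 A) g1 g Hg D1 D2).
  apply Z.div_same; lia.
- now apply Hroot.
- now apply Hroot.
- simpl; rewrite opp_IZR; apply IZR_lt in Pc.
  rewrite (sign_neg (w - z)) by lra; apply sign_neg; nra.
Qed.

(** The sign convention makes [a] and [w - z] both negative, so the root of the discriminant is
    [a (w - z)]; partial fractions of [a (t - w) (t - z)] do the rest. *)
Lemma cycle_form_kernel (A : mat2) (w z : R) (t : C) :
  positive A -> w < 0 < z ->
  (forall u, repelling A u -> u = w) -> (forall u, attracting A u -> u = z) ->
  upper_half_plane t ->
  (RtoC (sqrt (IZR (qdisc (cycle_form A)))) / qeval (cycle_form A) t (RtoC 1))%C = kernel w z t.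
Proof.
intros HA Hwz Uw Uz Ht.
assert (HQ := epsilon_spec (inhabits (QForm 0 0 0)) (is_cycle_form A) (is_cycle_form_exists A HA)).
fold (cycle_form A) in HQ; set (Q := cycle_form A) in *.
destruct HQ as (w' & z' & Rw & Az & _ & Qw & Qz & Hsgn).
rewrite (Uw w' Rw), (Uz z' Az) in *.
rewrite qeval_real in Qw, Qz.
apply RtoC_inj in Qw, Qz.
set (a := IZR (qa Q)) in *; set (b := IZR (qb Q)) in *; set (c := IZR (qc Q)) in *.
assert (Ha : a < 0).
  rewrite (sign_neg (w - z)) in Hsgn by lra.
  destruct (Rlt_le_dec a 0) as [H|H]; [exact H|].
  apply sign_ge_0 in H; lra.
assert (Eb : b = - a * (w + z)).
  apply (Rmult_eq_reg_l (w - z)); [|lra]; nra.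
assert (Ec : c = a * w * z) by (rewrite Eb in Qw; nra).
assert (Es : sqrt (IZR (qdisc Q)) = a * (w - z)).
  replace (IZR (qdisc Q)) with ((a * (w - z)) * (a * (w - z))).
    apply sqrt_square; nra.
  unfold qdisc; replace (qb Q ^ 2)%Z with (qb Q * qb Q)%Z by ring.
  rewrite minus_IZR, !mult_IZR; fold a b c; rewrite Eb, Ec; ring.
rewrite Es.
replace (qeval Q t (RtoC 1)) with (RtoC a * ((t - RtoC w) * (t - RtoC z)))%C.
2: { unfold qeval, ZtoC; fold a b c; rewrite Eb, Ec.
     rewrite !RtoC_mult, RtoC_opp, RtoC_plus; ring. }
unfold kernel; rewrite RtoC_mult, RtoC_minus.
assert (H1 := C_neq_real t w Ht); assert (H2 := C_neq_real t z Ht).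
assert (H3 : RtoC a <> 0%C) by (apply RtoC_neq_0; lra).
field; repeat split; assumption.
Qed.

Definition rho2 : C := arc (2 * PI / 3).

Lemma rho2_upper_half_plane : upper_half_plane rho2.
Proof. apply arc_upper_half_plane; assert (H := PI_RGT_0); lra. Qed.

Lemma holomorphic_mult_kernel (f : C -> C) (w z : R) :
  weakly_holomorphic_modular f -> holomorphic (fun t => f t * kernel w z t)%C.
Proof.
intros Hf; apply holomorphic_mult; [now apply weakly_holomorphic_modular_holomorphic|].
apply holomorphic_kernel.
Qed.

Lemma segment_integral_ext (F G : C -> C) (a b : C) :
  (forall t, upper_half_plane t -> F t = G t) -> upper_half_plane a -> upper_half_plane b ->
  segment_integral F a b = segment_integral G a b.
Proof.
intros H Ha Hb; apply (RInt_ext (V := C_R_CompleteNormedModule)); intros t.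
rewrite Rmin_left, Rmax_right by lra; intros Ht.
rewrite H; [reflexivity|]; apply upper_half_plane_segment; [assumption|assumption|lra].
Qed.

(** Moves the base point to [rho2]. The repelling point is written [- x] with [x > 0] to suit
    [mrev]. *)
Lemma cycle_integral_hyperbolic (f : C -> C) (A : mat2) :
  weakly_holomorphic_modular f -> positive A ->
  exists x z, 0 < x /\ 0 < z /\ mobiusR A z = z /\ fixed_point A (- x) /\
    forall Phi, is_primitive (fun t => f t * kernel (- x) z t)%C Phi ->
    forall tau0, upper_half_plane tau0 ->
      cycle_integral f tau0 A = (Phi (mobius A rho2) - Phi rho2)%C.
Proof.
intros Hf HA.
destruct (positive_fixed_points A HA) as (w & z & Hwz & Rw & Az & Uw & Uz).
exists (- w), z; rewrite Ropp_involutive.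
split; [lra|]; split; [lra|]; split; [apply Az|]; split; [apply Rw|].
intros Phi HPhi tau0 Ht0.
assert (HS := proj2 (proj1 HA)).
assert (HAt := mobius_upper_half_plane A tau0 HS Ht0).
unfold cycle_integral; destruct (excluded_middle_informative (hyperbolic A)) as [_|n];
  [|now destruct (n (positive_hyperbolic A HA))].
rewrite (segment_integral_ext _ (fun t => f t * kernel w z t)%C) by
  (try assumption; intros t Ht; rewrite <- (cycle_form_kernel A w z t) by assumption;
   unfold Cdiv; ring).
rewrite (segment_integral_primitive _ Phi) by (try assumption; now apply holomorphic_mult_kernel).
(* As [A] fixes both poles, the integrand is its own pullback, so this difference is constant in
   [t]: this is the independence of the base point. *)
assert (HD : is_primitive (fun _ => RtoC 0) (fun t => Phi (mobius A t) - Phi t)%C).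
  eapply is_primitive_ext; [|exact (is_primitive_minus _ _ _ _
    (is_primitive_pullback f (kernel w z) Phi A Hf HS HPhi) HPhi)].
  intros t Ht; cbv beta.
  rewrite <- (pullback_kernel A w z t) by (assumption || apply Rw || apply Az).
  rewrite (proj2 (proj1 Rw)), (proj2 (proj1 Az)); ring.
assert (E := primitive_eq _ _ (fun _ => RtoC 0) rho2 tau0 (holomorphic_const _) HD
  (fun z _ => is_Cderive_const _ z) rho2_upper_half_plane Ht0).
cbv beta in E.
transitivity ((Phi (mobius A tau0) - Phi tau0 - (Phi (mobius A rho2) - Phi rho2))
  + (Phi (mobius A rho2) - Phi rho2))%C; [ring|rewrite E; ring].
Qed.

Lemma mobius_tv_rho2 (b : bool) : mobius (tv b) rho2 = arc (PI / 3).
Proof.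
assert (E2 : rho2 = (- (1 / 2), sqrt 3 / 2)).
  unfold rho2, arc; replace (2 * PI / 3) with (2 * (PI / 3)) by field.
  rewrite cos_2PI3, sin_2PI3; f_equal; field.
assert (E1 : arc (PI / 3) = (1 / 2, sqrt 3 / 2)) by (unfold arc; now rewrite cos_PI3, sin_PI3).
assert (H3 : sqrt 3 * sqrt 3 = 3) by (apply sqrt_sqrt; lra).
assert (E : arc (PI / 3) = (rho2 + 1)%C).
  rewrite E1, E2; unfold Cplus, RtoC; simpl; f_equal; field.
assert (E' : (arc (PI / 3) * arc (PI / 3))%C = rho2).
  rewrite E1, E2; unfold Cmult; simpl; f_equal; nra.
assert (Hn : arc (PI / 3) <> 0%C) by (rewrite E1; intros H; injection H; lra).
unfold mobius, ZtoC; destruct b; simpl.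
- rewrite E; field; intros H; injection H; lra.
- replace (RtoC 1 * rho2 + RtoC 1)%C with (arc (PI / 3)) by (rewrite E; ring).
  rewrite <- E'; field; assumption.
Qed.

Lemma holomorphic_pullback (A : mat2) (k : C -> C) :
  in_SL2Z A -> holomorphic k -> holomorphic (pullback A k).
Proof.
intros HA Hk; apply (holomorphic_mult (fun t => k (mobius A t)) (fun t => / (mob_den A t * mob_den A t))%C);
  intros t Ht.
- destruct (Hk _ (mobius_upper_half_plane A t HA Ht)) as [l Hl].
  eexists; apply is_Cderive_comp; [exact Hl|now apply is_Cderive_mobius].
- assert (Hd := mob_den_neq_0 A t HA Ht).
  eexists; apply (is_Cderive_comp Cinv (fun t => mob_den A t * mob_den A t)%C).
    apply is_Cderive_inv; now apply Cmult_neq_0.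
  apply is_Cderive_mult; apply is_Cderive_linear.
Qed.

(** Telescoping over the letters: a further letter moves [rho2] to the other end of the arc, so the
    new increment is that of [Phi], pulled back by the prefix, over one arc. *)
Lemma wprod_path_bound (f k Phi : C -> C) (X : nat -> bool) (s : nat) (M : R) (m : nat -> R) (l : nat) :
  weakly_holomorphic_modular f -> holomorphic k ->
  is_primitive (fun t => f t * k t)%C Phi ->
  (forall t, PI / 3 <= t <= 2 * PI / 3 -> Cmod (f (arc t)) <= M) ->
  (forall j, (j < l)%nat -> forall t, PI / 3 <= t <= 2 * PI / 3 ->
     Cmod (pullback (wprod X s j) k (arc t)) <= m j) ->
  Cmod (Phi (mobius (wprod X s l) rho2) - Phi rho2) <= M * (PI / 3) * psum m l.
Proof.
intros Hf Hk HPhi HM.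
assert (HM0 : 0 <= M).
  assert (H := PI_RGT_0); eapply Rle_trans; [apply Cmod_ge_0|apply (HM (PI / 3)); lra].
assert (Hhol := weakly_holomorphic_modular_holomorphic f Hf).
induction l as [|l IH]; intros Hm.
- replace (mobius (wprod X s 0) rho2) with rho2.
    replace (Phi rho2 - Phi rho2)%C with (RtoC 0) by ring; rewrite Cmod_0; simpl; lra.
  unfold mobius, ZtoC; simpl; field; intros H; injection H; lra.
- assert (HP := proj2 (nonneg_wprod X l s)).
  rewrite wprod_S, mobius_mmul, mobius_tv_rho2;
    [|exact HP|apply nonneg_tv|apply rho2_upper_half_plane].
  eapply Rle_trans; [apply (Cmod_triangle_minus _ (Phi (mobius (wprod X s l) rho2)))|].
  assert (E := IH (fun j Hj => Hm j (Nat.lt_lt_succ_r _ _ Hj))).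
  assert (E2 := primitive_arc_bound (fun t => f t * pullback (wprod X s l) k t)%C
    (fun t => Phi (mobius (wprod X s l) t)) (M * m l)
    (holomorphic_mult _ _ Hhol (holomorphic_pullback _ _ HP Hk))
    (is_primitive_pullback f k Phi _ Hf HP HPhi)).
  simpl psum.
  eapply Rle_trans; [apply Rplus_le_compat; [apply E2|exact E]|right; ring].
  intros t Ht; rewrite Cmod_mult.
  apply Rmult_le_compat; try apply Cmod_ge_0; [now apply HM|apply Hm; [lia|assumption]].
Qed.

(** The reason for writing the right pole as the image of [z] under the whole word: undoing a prefix
    leaves the image of [z] under the remaining suffix. *)
Lemma pullback_wprod_kernel (X : nat -> bool) (s l j : nat) (x z : R) (t : C) :
  (j <= l)%nat -> 0 < x -> 0 < z -> upper_half_plane t ->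
  pullback (wprod X s j) (kernel (- x) (mobiusR (wprod X s l) z)) t =
  kernel (- mobiusR (mrev (wprod X s j)) x) (mobiusR (wprod X (s + j) (l - j)) z) t.
Proof.
intros Hj Hx Hz Ht.
assert (HP := nonneg_wprod X j s); assert (HW := nonneg_wprod X (l - j) (s + j)).
assert (Hz1 := mobiusR_pos _ z HW Hz).
destruct (nonneg_IZR _ HP) as (H1 & H2 & H3 & H4).
destruct (mobiusR_mrev _ x HP Hx) as [N1 E1].
replace l with (j + (l - j))%nat at 1 by lia.
rewrite wprod_add, mobiusR_mmul by assumption.
rewrite <- E1 at 1.
apply pullback_kernel; [apply HP|assumption|assumption|nra].
Qed.

(** * Comparison of cycle integrals along a word *)

Section Word.

Variables (f : C -> C) (M : R) (X : nat -> bool) (N : nat).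
Hypothesis Hf : weakly_holomorphic_modular f.
Hypothesis HM : forall t, PI / 3 <= t <= 2 * PI / 3 -> Cmod (f (arc t)) <= M.
Hypothesis HX : runs_below N X.

Lemma runs_below_pos : (0 < N)%nat.
Proof. destruct (HX O) as [r [Hr _]]; lia. Qed.

Lemma bound_nonneg : 0 <= M * (PI / 3).
Proof.
assert (H := PI_RGT_0).
apply Rmult_le_pos; [|lra].
eapply Rle_trans; [apply Cmod_ge_0|apply (HM (PI / 3)); lra].
Qed.

(** [mrev] turns [N] letters appended on the right into a positive factor on the left, where
    [chord_mmul] applies. The constant is [4/3] times the bound 4 on [chord]. *)
Lemma psum_chord_prefix (s l : nat) :
  psum (fun j => chord (mrev (wprod X s j))) l <= 16 / 3 * INR N.
Proof.
replace (16 / 3) with (4 / 3 * 4) by field.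
apply psum_geometric; [apply runs_below_pos|lra| |].
- intros j _; apply chord_le, nonneg_mrev, nonneg_wprod.
- intros j _; rewrite wprod_add, mrev_mmul.
  apply chord_mmul; [|apply nonneg_mrev, nonneg_wprod].
  apply positive_mrev, (positive_wprod X N); [exact HX|lia].
Qed.

(** Suffixes shrink as [j] grows, so the sum is read backwards: each then arises from an earlier one
    by putting [N] letters in front. *)
Lemma psum_chord_suffix (s l : nat) :
  psum (fun j => chord (wprod X (s + j) (l - j))) l <= 16 / 3 * INR N.
Proof.
rewrite <- psum_rev.
replace (16 / 3) with (4 / 3 * 4) by field.
apply psum_geometric; [apply runs_below_pos|lra| |].
- intros j _; apply chord_le, nonneg_wprod.
- intros j Hj.
  replace (l - (l - S (j + N)))%nat with (N + (l - (l - S j)))%nat by lia.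
  rewrite wprod_add.
  replace (s + (l - S (j + N)) + N)%nat with (s + (l - S j))%nat by lia.
  apply chord_mmul; [|apply nonneg_wprod].
  apply (positive_wprod X N); [exact HX|lia].
Qed.

(** After [j] letters both left poles lie in one interval and both right poles in another, whatever
    the positive parameters; prefixes and suffixes each contribute [16/3 * INR N]. *)
Lemma wprod_primitive_compare (s l : nat) (x z x' z' : R) (Phi Psi : C -> C) :
  0 < x -> 0 < z -> 0 < x' -> 0 < z' ->
  is_primitive (fun t => f t * kernel (- x) (mobiusR (wprod X s l) z) t)%C Phi ->
  is_primitive (fun t => f t * kernel (- x') (mobiusR (wprod X s l) z') t)%C Psi ->
  Cmod (Phi (mobius (wprod X s l) rho2) - Phi rho2
        - (Psi (mobius (wprod X s l) rho2) - Psi rho2)) <= M * (PI / 3) * (32 / 3 * INR N).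
Proof.
intros Hx Hz Hx' Hz' HPhi HPsi.
set (k := kernel (- x) (mobiusR (wprod X s l) z)) in *.
set (k' := kernel (- x') (mobiusR (wprod X s l) z')) in *.
replace (_ - _)%C with ((Phi (mobius (wprod X s l) rho2) - Psi (mobius (wprod X s l) rho2))
  - (Phi rho2 - Psi rho2))%C by ring.
apply Rle_trans with (M * (PI / 3) * psum (fun j => chord (mrev (wprod X s j))
  + chord (wprod X (s + j) (l - j))) l).
- apply (wprod_path_bound f (fun t => k t - k' t)%C (fun t => Phi t - Psi t)%C);
    [exact Hf|apply holomorphic_minus; apply holomorphic_kernel| |exact HM|].
  + eapply is_primitive_ext; [|exact (is_primitive_minus _ _ _ _ HPhi HPsi)].
    intros t _; cbv beta; ring.
  + intros j Hj t Ht.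
    assert (Ha := arc_upper_half_plane t Ht).
    replace (pullback (wprod X s j) (fun t => k t - k' t)%C (arc t))
      with (pullback (wprod X s j) k (arc t) - pullback (wprod X s j) k' (arc t))%C
      by (unfold pullback; ring).
    unfold k, k'; rewrite !pullback_wprod_kernel by (assumption || lia).
    assert (HP := nonneg_mrev _ (nonneg_wprod X j s)).
    assert (HW := nonneg_wprod X (l - j) (s + j)).
    set (P := mrev (wprod X s j)) in *; set (W := wprod X (s + j) (l - j)) in *.
    (* Regrouping the four poles pairs the left ones together and the right ones together; within
       each pair they are close. *)
    replace (_ - _)%C with (kernel (- mobiusR P x) (- mobiusR P x') (arc t)
      + - kernel (mobiusR W z) (mobiusR W z') (arc t))%C by (unfold kernel; ring).
    eapply Rle_trans; [apply Cmod_triangle|]; rewrite Cmod_opp.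
    apply Rplus_le_compat.
    * eapply Rle_trans; [now apply kernel_opp_arc_bound|now apply mobiusR_chord].
    * eapply Rle_trans; [now apply kernel_arc_bound_chordal|now apply mobiusR_chord].
- apply Rmult_le_compat_l; [apply bound_nonneg|].
  rewrite psum_plus.
  assert (H1 := psum_chord_prefix s l); assert (H2 := psum_chord_suffix s l); lra.
Qed.

(** Fewer than [N] arcs, each with kernel at most 4; the constant is enlarged to match
    [wprod_primitive_compare]. *)
Lemma wprod_primitive_short (s l : nat) (x z : R) (Phi : C -> C) :
  (l < N)%nat -> 0 < x -> 0 < z ->
  is_primitive (fun t => f t * kernel (- x) (mobiusR (wprod X s l) z) t)%C Phi ->
  Cmod (Phi (mobius (wprod X s l) rho2) - Phi rho2) <= M * (PI / 3) * (32 / 3 * INR N).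
Proof.
intros Hl Hx Hz HPhi.
apply Rle_trans with (M * (PI / 3) * psum (fun _ => 4) l).
- apply (wprod_path_bound f _ Phi X s M (fun _ => 4) l Hf (holomorphic_kernel _ _) HPhi HM).
  intros j Hj t Ht; rewrite pullback_wprod_kernel;
    [now apply kernel_arc_bound|lia|assumption|assumption|now apply arc_upper_half_plane].
- apply Rmult_le_compat_l; [apply bound_nonneg|]; rewrite psum_const.
  apply lt_INR in Hl; assert (H := pos_INR l); lra.
Qed.

(** A hyperbolic word is compared with its own kernel. Otherwise the cycle integral is 0 and the
    word is shorter than [N], since [N] letters already make it positive. *)
Lemma wprod_cycle_defect (s l : nat) (x z : R) (Phi : C -> C) (tau0 : C) :
  0 < x -> 0 < z -> upper_half_plane tau0 ->
  is_primitive (fun t => f t * kernel (- x) (mobiusR (wprod X s l) z) t)%C Phi ->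
  Cmod (Phi (mobius (wprod X s l) rho2) - Phi rho2 - cycle_integral f tau0 (wprod X s l))
    <= M * (PI / 3) * (32 / 3 * INR N).
Proof.
intros Hx Hz Ht0 HPhi.
destruct (excluded_middle_informative (hyperbolic (wprod X s l))) as [Hh|Hh].
- destruct (cycle_integral_hyperbolic f (wprod X s l) Hf
    (hyperbolic_positive _ (nonneg_wprod X l s) Hh)) as (x' & z' & Hx' & Hz' & Ez & _ & HI).
  destruct (holomorphic_has_primitive _ (holomorphic_mult_kernel f (- x') z' Hf)) as [Psi HPsi].
  rewrite (HI Psi HPsi tau0 Ht0).
  (* The attracting point [z'] is replaced by its image under the word, the form required of a right
     pole. *)
  rewrite <- Ez in HPsi.
  now apply (wprod_primitive_compare s l x z x' z').
- unfold cycle_integral.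
  destruct (excluded_middle_informative (hyperbolic (wprod X s l))) as [Hh'|_]; [easy|].
  replace (_ - RtoC 0)%C with (Phi (mobius (wprod X s l) rho2) - Phi rho2)%C by ring.
  apply (wprod_primitive_short s l x z); try assumption.
  destruct (Nat.lt_ge_cases l N) as [H|H]; [exact H|].
  destruct (Hh (positive_hyperbolic _ (positive_wprod X N s l HX H))).
Qed.

(** The increment of [Phi] is split at [mobius P rho2]; the second part is pulled back by [P]. Each
    part costs one [wprod_cycle_defect], whence the factor 2. *)
Lemma cycle_integral_quasimorphism (n m : nat) (tau0 : C) :
  upper_half_plane tau0 ->
  Cmod (cycle_integral f tau0 (wprod X 0 (n + m)) - cycle_integral f tau0 (wprod X 0 n)
        - cycle_integral f tau0 (wprod X n m)) <= 2 * (M * (PI / 3) * (32 / 3 * INR N)).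
Proof.
intros Ht0.
assert (Hb := bound_nonneg); assert (HN := pos_INR N).
assert (EA := wprod_add X n m 0); simpl in EA.
set (P := wprod X 0 n) in *; set (B := wprod X n m) in *.
assert (HP : nonneg P) by apply nonneg_wprod.
assert (HB : nonneg B) by apply nonneg_wprod.
rewrite EA.
destruct (excluded_middle_informative (hyperbolic (mmul P B))) as [Hh|Hh].
- apply hyperbolic_positive in Hh; [|now apply nonneg_mmul].
  destruct (cycle_integral_hyperbolic f _ Hf Hh) as (x & z & Hx & Hz & Ez & Fx & HI).
  destruct (holomorphic_has_primitive _ (holomorphic_mult_kernel f (- x) z Hf)) as [Phi HPhi].
  rewrite (HI Phi HPhi tau0 Ht0), mobius_mmul
    by (apply HP || apply HB || apply rho2_upper_half_plane).
  assert (HBz := mobiusR_pos B z HB Hz).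
  (* The point [z] is fixed by [P B], hence equals [P (B z)]: a right pole for the word [P] with
     parameter [B z]. *)
  rewrite mobiusR_mmul in Ez by assumption.
  assert (D1 := HPhi); rewrite <- Ez in D1.
  assert (E1 := wprod_cycle_defect 0 n x (mobiusR B z) Phi tau0 Hx HBz Ht0 D1).
  assert (D2 : is_primitive (fun t => f t * kernel (- mobiusR (mrev P) x) (mobiusR B z) t)%C
     (fun t => Phi (mobius P t))).
    eapply is_primitive_ext; [|exact (is_primitive_pullback _ _ _ P Hf (proj2 HP) D1)].
    intros t Ht; cbv beta; f_equal.
    destruct (mobiusR_mrev P x HP Hx) as [N1 F1].
    rewrite <- F1 at 1; destruct (nonneg_IZR P HP) as (H1 & H2 & H3 & H4).
    apply pullback_kernel; [apply HP|assumption|assumption|nra].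
  assert (E2 := wprod_cycle_defect n m (mobiusR (mrev P) x) z _ tau0
    (mobiusR_pos _ x (nonneg_mrev P HP) Hx) Hz Ht0 D2).
  fold P in E1; fold B in E2; cbv beta in E2.
  match goal with |- Cmod ?e <= _ => replace e with
    ((Phi (mobius P rho2) - Phi rho2 - cycle_integral f tau0 P)
     + (Phi (mobius P (mobius B rho2)) - Phi (mobius P rho2) - cycle_integral f tau0 B))%C
    by ring end.
  eapply Rle_trans; [apply Cmod_triangle|]; lra.
(* Positivity of a factor would pass to the product, so here all three integrals are 0. *)
- assert (HhP : ~ hyperbolic P)
    by (intros H; apply Hh, positive_hyperbolic, positive_mmul_l; [now apply hyperbolic_positive|exact HB]).
  assert (HhB : ~ hyperbolic B)
    by (intros H; apply Hh, positive_hyperbolic, positive_mmul_r; [exact HP|now apply hyperbolic_positive]).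
  unfold cycle_integral.
  destruct (excluded_middle_informative (hyperbolic (mmul P B))); [easy|].
  destruct (excluded_middle_informative (hyperbolic P)); [easy|].
  destruct (excluded_middle_informative (hyperbolic B)); [easy|].
  replace (RtoC 0 - RtoC 0 - RtoC 0)%C with (RtoC 0) by ring.
  rewrite Cmod_0; nra.
Qed.

End Word.

Theorem theorem2p9 :
  exists K : R, 0 < K /\
  forall (x : R) (c : R) (A : nat -> mat2),
    0 < x -> irrational x ->
    0 < c -> (forall i : nat, INR (partial_quotient x i) <= c) ->
    associated_sequence x A ->
    forall (m n : nat) (B : mat2), A (m + n)%nat = mmul (A n) B ->
    forall f : C -> C, weakly_holomorphic_modular f ->
    forall tau0 : C, upper_half_plane tau0 ->
      Rbar_le
        (Finite (Cmod (cycle_integral f tau0 (A (m + n)%nat)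
                       - cycle_integral f tau0 (A n)
                       - cycle_integral f tau0 B)%C))
        (Rbar_mult (Finite (K * c)) (arc_sup f)).
Proof.
(* The total is [64/9 * M * PI * N] with [PI <= 4] and [N <= 2 * c], that is at most
   [512/9 * M * c], below [57 * M * c]. *)
exists 100; split; [lra|].
intros x c A Hx Hirr Hc Hpq HA m n B HB f Hf tau0 Ht0.
(* Gives [up c <= c + 1 <= 2 * c], while [up c > c] makes [N] exceed every partial quotient
   strictly. *)
assert (Hc1 : 1 <= c).
  eapply Rle_trans; [|apply (Hpq 1%nat)]; apply (le_INR 1), partial_quotient_pos, Hirr.
destruct (archimed c) as [Hup1 Hup2].
set (N := Z.to_nat (up c)).
assert (HN : INR N = IZR (up c))
  by (unfold N; rewrite INR_IZR_INZ, Z2Nat.id; [reflexivity|apply le_IZR; lra]).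
destruct (associated_sequence_word x Hirr A N HA) as [X [HX HAX]].
  intros i; apply INR_lt; specialize (Hpq i); lra.
assert (EB : B = wprod X n m).
  rewrite !HAX, Nat.add_comm, wprod_add in HB.
  symmetry; apply (mmul_cancel_l (wprod X 0 n)); [apply nonneg_wprod|exact HB].
rewrite !HAX, EB, (Nat.add_comm m n); clear EB HB HAX.
assert (Hmem : forall t, PI / 3 <= t <= 2 * PI / 3 ->
   Rbar_le (Cmod (f (arc t))) (arc_sup f)).
  intros t Ht; apply Lub_Rbar_correct; exists t; split; [exact Ht|].
  now rewrite Cexp_Ci.
(* An infinite supremum makes the bound trivial because [100 * c > 0]; minus infinity is excluded
   since the arc is not empty. *)
destruct (arc_sup f) as [M| |].
- assert (H := cycle_integral_quasimorphism f M X N Hf Hmem HX n m tau0 Ht0).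
  eapply Rle_trans; [exact H|]; simpl.
  assert (Hpi := PI_4); assert (Hpi0 := PI_RGT_0).
  assert (HM : 0 <= M).
    eapply Rle_trans; [apply Cmod_ge_0|apply (Hmem (PI / 3)); lra].
  assert (PI * INR N <= 4 * (2 * c)) by (apply Rmult_le_compat; lra).
  replace (2 * (M * (PI / 3) * (32 / 3 * INR N))) with (64 / 9 * M * (PI * INR N)) by field.
  apply Rle_trans with (64 / 9 * M * (4 * (2 * c))); [apply Rmult_le_compat_l; lra|nra].
- unfold Rbar_mult, Rbar_mult'.
  destruct (Rle_dec 0 (100 * c)) as [H|H]; [|lra].
  destruct (Rle_lt_or_eq_dec 0 (100 * c) H); [exact I|lra].
- assert (Hpi0 := PI_RGT_0); destruct (Hmem (PI / 3)); lra.
Qed.
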